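(* Let $(R,\mathfrak m)$ be a Noetherian local ring of dimension $d\ge1$ with infinite residue field, and let $I$ be an $\mathfrak m$-primary almost complete intersection ideal with a minimal reduction $Q$. If $\lambda(I^n/QI^{n-1})=1$ for some integer $n>0$, then $\mathrm r(I)\le n\,\nu(\mathfrak m)-1$.
   Context: $\lambda(\cdot)$ denotes length and $\nu(\cdot)$ the minimal number of generators. An $\mathfrak m$-primary ideal $I$ of a local ring of dimension $d$ is an almost complete intersection if it is minimally generated by $d+1$ elements. A minimal reduction of $I$ is an ideal $Q=(a_1,\dots,a_d)\subset I$ generated by $d=\dim R$ elements with $I^{n+1}=QI^n$ for some $n\ge0$; the least such $n$ is $\mathrm r_Q(I)$, and $\mathrm r(I)=\inf\{\mathrm r_Q(I)\mid Q\text{ a minimal reduction of }I\}$. *)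

(* Defs.v *)
From HB Require Import structures.
From mathcomp Require Import all_boot all_order all_algebra.
From mathcomp Require Import boolp classical_sets functions cardinality.

Set Implicit Arguments.
Unset Strict Implicit.
Unset Printing Implicit Defensive.

Import GRing.Theory.

Local Open Scope classical_set_scope.
Local Open Scope ring_scope.

(* The infimum of a nonempty set of natural numbers; [least set0] is the junk
   value 0. *)
Definition least (A : set nat) : nat :=
  xget 0%N [set n | A n /\ forall k, A k -> (n <= k)%N].

Section Chains.
Variable T : Type.

(* A chain X_0 < X_1 < ... < X_k has [k] strict inclusions. *)
Definition has_chain (C : set (set T)) (k : nat) : Prop :=
  exists X : 'I_k.+1 -> set T,
    (forall i, C (X i)) /\ {homo X : i j / (i < j)%N >-> i `<` j}.

(* The supremum of the numbers of strict inclusions is finite and equal to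
   [k]. *)
Definition chain_height (C : set (set T)) (k : nat) : Prop :=
  has_chain C k /\ forall l, has_chain C l -> (l <= k)%N.

End Chains.

Section Ideals.
Variable R : comNzRingType.
Implicit Types (I J K P Q : set R) (d k n : nat).

(* Ideals are the submodules of R over itself, so R is an ideal, whereas
   [idealr_closed] and [idealr] are about proper ideals only. *)
Definition ideal I : Prop := submod_closed ([in I] : {pred R^o}).

Definition ideal_span (G : set R) : set R := smallest ideal G.

Definition ideal_mul I J : set R :=
  ideal_span [set x * y | x in I & y in J].

Definition ideal_exp I n : set R := iter n (ideal_mul I) setT.

Definition radical I : set R := [set x | exists n, I (x ^+ n)].

Definition prime_ideal P : Prop :=
  idealr_closed [in P] /\ prime_idealr_closed [in P].

Definition maximal_ideal P : Prop :=
  idealr_closed [in P] /\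
  forall J, idealr_closed [in J] -> P `<=` J -> J = P.

Definition primary_ideal I : Prop :=
  idealr_closed [in I] /\ forall x y, I (x * y) -> I x \/ exists n, I (y ^+ n).

Definition noetherian : Prop :=
  forall I, ideal I -> exists s : seq R, I = ideal_span [set` s].

Definition local_ring (m : idealr R) : Prop :=
  forall P, maximal_ideal P <-> P = [set` m].

Definition krull_dim d : Prop := chain_height prime_ideal d.

(* The submodules of J / K are the L / K, where L is an ideal with K <= L <= J,
   so that chains of such ideals L compute the length of J / K. *)
Definition quotient_length J K k : Prop :=
  [/\ ideal J, ideal K, K `<=` J &
      chain_height [set L | [/\ ideal L, K `<=` L & L `<=` J]] k].

Definition nu I : nat :=
  least [set size s | s in [set s : seq R | I = ideal_span [set` s]]].

Definition ideal_primary_to (m : idealr R) I : Prop :=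
  primary_ideal I /\ radical I = [set` m].

Definition almost_complete_intersection (m : idealr R) d I : Prop :=
  ideal_primary_to m I /\ nu I = d.+1.

(* [d] stands for the dimension of the ring. *)
Definition minimal_reduction d I Q : Prop :=
  [/\ exists a : d.-tuple R, Q = ideal_span [set` a],
      Q `<=` I &
      exists n, ideal_exp I n.+1 = ideal_mul Q (ideal_exp I n)].

Definition reduction_number_wrt Q I : nat :=
  least [set n | ideal_exp I n.+1 = ideal_mul Q (ideal_exp I n)].

Definition reduction_number d I : nat :=
  least [set reduction_number_wrt Q I | Q in minimal_reduction d I].

End Ideals.

(* Main.v *)
Require Import Defs.
From HB Require Import structures.
From mathcomp Require Import all_boot all_order all_algebra.
From mathcomp Require Import boolp classical_sets functions cardinality.
From mathcomp Require Import ring zify.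

(** The maximal ideal [m] has generators y_1, ..., y_k with k = nu(m), and the
    reduction Q is generated by a_1, ..., a_d. Let N = n k.

    By Krull's height theorem no ideal with fewer than d generators is a
    reduction of I, so the a_l are part of a minimal system of generators of I
    and I = Q + (x) for some x ([reduction_complement]). Since
    I^n / Q I^(n-1) has length one, Nakayama's lemma gives
    m x^n <= Q I^(n-1). Two cases arise.

    If some w x^n with w in m lies outside m Q I^(n-1), then writing it as an
    element of Q I^(n-1) exhibits a form of degree n in x and the a_l that
    vanishes and has a unit coefficient. As the residue field is infinite, a
    linear change of coordinates makes this form monic in x: the ideal
    Q' = (a_l - t_l x) satisfies x^n in Q' I^(n-1) for suitable t_l
    ([unit_form]). Hence r(I) <= n - 1.

    Otherwise x^n y = C y for the column y of the y_j and a matrix C with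
    entries in Q I^(n-1). The determinant of x^n - C is x^N modulo
    Q I^(N-1), so the bound r(I) <= N - 1 holds for Q itself as soon as this
    determinant is zero. Cramer's rule only says that it kills m, which does
    not suffice when R has depth zero. That it vanishes is the heart of the
    proof, and this uses d >= 1.

    The tool is the following remark. Let the rows of a square matrix kill y.
    Adding to one of them a Koszul relation (u.y) v - (v.y) u does not change
    the determinant ([null_row_koszul]), because the cofactors along a row are
    proportional to the y_j. So each row may be replaced by one that is congruent to it
    modulo such relations, and it is enough to reach rows that depend on each
    other.

    - If k >= d + 2, the rows of C are combinations of the a_l = q_l.y, and the
      swap turns x^n - C into x^n - P Q for a k x d matrix P and the matrix Q
      with rows q_l. By Sylvester's identity the determinant is x^(n (k-d)) E
      with E = det (x^n - Q P), and E kills every a_l. As x^(n+1) lies in Q,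
      this is zero ([det_few_coefficients]).

    - If k <= d + 1, the determinant of any matrix of relations on y vanishes.
      The ideal p0 of all y_j but two, say y_0 and y_1, does not have m as
      its radical, say y_1 is not nilpotent modulo p0. Let H be the
      saturation of p0 by y_1. Modulo H + (y_1) the maximal ideal is
      principal, hence modulo H the relations on y_0 and y_1 are generated by
      the Koszul relation and one vector g, and then H = p0 + (g.y). It follows
      that every relation on y is congruent modulo Koszul relations to a
      combination of g and the unit vectors e_j for the y_j in p0, which are
      only k - 1 vectors ([det_relations_eq0]). *)

Set Implicit Arguments.
Unset Strict Implicit.
Unset Printing Implicit Defensive.

Import GRing.Theory.

Local Open Scope classical_set_scope.
Local Open Scope ring_scope.

(** * Ideals *)

Section Ideals.
Variable R : comNzRingType.
Implicit Types (I J K L : set R) (G : set R).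

Lemma idealP I :
  ideal I <-> I 0 /\ forall a u v, I u -> I v -> I (a * u + v).
Proof.
rewrite /ideal /GRing.submod_closed; split=> -[I0 Il]; split.
- by move: I0; rewrite inE.
- move=> a u v Iu Iv; have /(_ u v) := Il a; rewrite !inE; exact.
- by rewrite inE.
- by move=> a u v; rewrite !inE => Iu Iv; exact: Il.
Qed.

Section Closure.
Variable I : set R.
Hypothesis idI : ideal I.

Lemma ideal0 : I 0. Proof. by case/idealP: idI. Qed.

Lemma idealMl a u : I u -> I (a * u).
Proof.
by case/idealP: idI => I0 Il Iu; rewrite -[a * u]addr0; apply: Il.
Qed.

Lemma idealMr a u : I u -> I (u * a).
Proof. by rewrite mulrC; exact: idealMl. Qed.

Lemma idealD u v : I u -> I v -> I (u + v).
Proof.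
by case/idealP: idI => I0 Il Iu Iv; rewrite -[u]mul1r; apply: Il.
Qed.

Lemma idealN u : I u -> I (- u).
Proof. by rewrite -mulN1r; exact: idealMl. Qed.

Lemma idealB u v : I u -> I v -> I (u - v).
Proof. by move=> Iu Iv; apply: idealD => //; exact: idealN. Qed.

Lemma ideal_sum (T : Type) (s : seq T) (P : pred T) (F : T -> R) :
  (forall i, P i -> I (F i)) -> I (\sum_(i <- s | P i) F i).
Proof. by move=> IF; elim/big_ind: _ => //; [exact: ideal0|exact: idealD]. Qed.

Lemma ideal_full : I 1 -> I = setT.
Proof.
by move=> I1; apply/seteqP; split=> // x _; rewrite -[x]mulr1; apply: idealMl.
Qed.

End Closure.

Lemma idealT : ideal (setT : set R).
Proof. by apply/idealP. Qed.

Lemma ideal_bigcap (T : Type) (D : set T) (F : T -> set R) :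
  (forall i, D i -> ideal (F i)) -> ideal (\bigcap_(i in D) F i).
Proof.
move=> idF; apply/idealP; split=> [i Di|a u v Fu Fv i Di].
  exact: ideal0 (idF _ Di).
apply: (idealD (idF _ Di)); last exact: Fv.
by apply: (idealMl (idF _ Di)); exact: Fu.
Qed.

Lemma ideal_spanP G : ideal (ideal_span G).
Proof. by apply: ideal_bigcap => K [idK _]. Qed.

Lemma sub_span G : G `<=` ideal_span G.
Proof. exact: sub_gen_smallest. Qed.

Lemma span_sub G I : ideal I -> G `<=` I -> ideal_span G `<=` I.
Proof. exact: smallest_sub. Qed.

(** Linear combinations are indexed by a sequence of pairs so that two of them
    can be concatenated. *)
Lemma spanP G x : ideal_span G x <->
  exists s : seq (R * R),
    (forall c, c \in s -> G c.2) /\ x = \sum_(c <- s) c.1 * c.2.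
Proof.
split=> [|[s [sG ->]]]; last first.
  rewrite big_seq; apply: (ideal_sum (ideal_spanP G)) => c cs.
  by apply: (idealMl (ideal_spanP G)); apply: sub_span; exact: sG.
pose S := [set x | exists s : seq (R * R),
  (forall c, c \in s -> G c.2) /\ x = \sum_(c <- s) c.1 * c.2].
apply: (@span_sub G S) => [|g Gg]; last first.
  exists [:: (1, g)]; split=> [c|]; first by rewrite inE => /eqP ->.
  by rewrite big_seq1 mul1r.
apply/idealP; split=> [|a u v [s [sG ->]] [t [tG ->]]].
  by exists [::]; split => //; rewrite big_nil.
exists ([seq (a * c.1, c.2) | c <- s] ++ t); split=> [c|].
  rewrite mem_cat => /orP[/mapP[c' c's ->]|]; [exact: (sG _ c's)|exact: tG].
rewrite big_cat big_map /= mulr_sumr; congr (_ + _).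
by apply: eq_bigr => c _; rewrite mulrA.
Qed.

Lemma span_seqP (s : seq R) x : ideal_span [set` s] x <->
  exists c : 'I_(size s) -> R, x = \sum_(i < size s) c i * s`_i.
Proof.
split=> [|[c ->]]; last first.
  apply: (ideal_sum (ideal_spanP _)) => i _.
  by apply: (idealMl (ideal_spanP _)); apply: sub_span => /=; exact: mem_nth.
pose S := [set x | exists c : 'I_(size s) -> R, x = \sum_(i < size s) c i * s`_i].
apply: (@span_sub _ S) => [|g /= gs].
  apply/idealP; split=> [|a u v [c ->] [c' ->]].
    by exists (fun=> 0); rewrite big1 // => i _; rewrite mul0r.
  exists (fun i => a * c i + c' i); rewrite mulr_sumr -big_split /=.
  by apply: eq_bigr => i _; rewrite mulrDl mulrA.
have is_ : (index g s < size s)%N by rewrite index_mem.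
exists (fun i => (i == Ordinal is_)%:R).
rewrite (bigD1 (Ordinal is_)) //= eqxx mul1r nth_index // big1 ?addr0 // => i.
by move=> /negPf->; rewrite mul0r.
Qed.

(** ** Sums, products and powers *)

Definition ideal_add I J : set R := [set u + v | u in I & v in J].

Lemma ideal_addP I J : ideal I -> ideal J -> ideal (ideal_add I J).
Proof.
move=> idI idJ; apply/idealP; split.
  by exists 0; [exact: ideal0|exists 0; [exact: ideal0|rewrite addr0]].
move=> a _ _ [u Iu [v Jv <-]] [u' Iu' [v' Jv' <-]].
exists (a * u + u'); first by apply: (idealD idI) => //; apply: (idealMl idI).
exists (a * v + v'); first by apply: (idealD idJ) => //; apply: (idealMl idJ).
by ring.
Qed.

Lemma ideal_addl I J : ideal J -> I `<=` ideal_add I J.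
Proof. by move=> idJ x Ix; exists x => //; exists 0; [exact: ideal0|rewrite addr0]. Qed.

Lemma ideal_addr I J : ideal I -> J `<=` ideal_add I J.
Proof. by move=> idI x Jx; exists 0; [exact: ideal0|exists x; rewrite ?add0r]. Qed.

Lemma ideal_add_sub I J K :
  ideal K -> I `<=` K -> J `<=` K -> ideal_add I J `<=` K.
Proof.
by move=> idK IK JK _ [u Iu [v Jv <-]]; apply: idealD => //; [exact: IK|exact: JK].
Qed.

Lemma ideal_mulP I J : ideal (ideal_mul I J).
Proof. exact: ideal_spanP. Qed.

Lemma mem_ideal_mul I J x y : I x -> J y -> ideal_mul I J (x * y).
Proof. by move=> Ix Jy; apply: sub_span; exists x => //; exists y. Qed.

Lemma ideal_mul_sub I J K : ideal K ->
  (forall x y, I x -> J y -> K (x * y)) -> ideal_mul I J `<=` K.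
Proof. by move=> idK IJK; apply: span_sub => // _ [x Ix [y Jy <-]]; exact: IJK. Qed.

Lemma ideal_mulC I J : ideal_mul I J = ideal_mul J I.
Proof.
by apply/seteqP; split; apply: ideal_mul_sub; try exact: ideal_mulP;
   move=> x y Hx Hy; rewrite mulrC; apply: mem_ideal_mul.
Qed.

Lemma ideal_mulS I I' J J' :
  I `<=` I' -> J `<=` J' -> ideal_mul I J `<=` ideal_mul I' J'.
Proof.
move=> II' JJ'; apply: ideal_mul_sub; first exact: ideal_mulP.
by move=> x y /II' Ix /JJ' Jy; apply: mem_ideal_mul.
Qed.

Lemma ideal_mulA I J K :
  ideal_mul I (ideal_mul J K) = ideal_mul (ideal_mul I J) K.
Proof.
apply/seteqP; split; apply: ideal_mul_sub; try exact: ideal_mulP.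
- move=> x y Ix; move: y.
  apply: (@ideal_mul_sub _ _ [set y | ideal_mul (ideal_mul I J) K (x * y)]).
    apply/idealP; split=> [|a u v /= Hu Hv].
      by rewrite /= mulr0; exact: (ideal0 (ideal_mulP _ _)).
    have -> : x * (a * u + v) = a * (x * u) + x * v by ring.
    by apply: (idealD (ideal_mulP _ _)) => //; apply: (idealMl (ideal_mulP _ _)).
  by move=> y z Jy Kz /=; rewrite mulrA; apply: mem_ideal_mul => //; apply: mem_ideal_mul.
- move=> x y + Ky; move: x.
  apply: (@ideal_mul_sub _ _ [set x | ideal_mul I (ideal_mul J K) (x * y)]).
    apply/idealP; split=> [|a u v /= Hu Hv].
      by rewrite /= mul0r; exact: (ideal0 (ideal_mulP _ _)).
    have -> : (a * u + v) * y = a * (u * y) + v * y by ring.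
    by apply: (idealD (ideal_mulP _ _)) => //; apply: (idealMl (ideal_mulP _ _)).
  by move=> x z Ix Jz /=; rewrite -mulrA; apply: mem_ideal_mul => //; apply: mem_ideal_mul.
Qed.

Lemma ideal_mulTl I : ideal I -> ideal_mul setT I = I.
Proof.
move=> idI; apply/seteqP; split; first by apply: ideal_mul_sub => // x y _; exact: idealMl.
by move=> x Ix; rewrite -[x]mul1r; apply: mem_ideal_mul.
Qed.

Lemma ideal_mul_subr I J : ideal J -> ideal_mul I J `<=` J.
Proof. by move=> idJ; apply: ideal_mul_sub => // x y _ Jy; apply: idealMl. Qed.

Lemma ideal_mul_subl I J : ideal I -> ideal_mul I J `<=` I.
Proof. by move=> idI; apply: ideal_mul_sub => // x y Ix _; apply: idealMr. Qed.

Lemma ideal_mulDl_sub I J K :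
  ideal_mul (ideal_add I J) K `<=` ideal_add (ideal_mul I K) (ideal_mul J K).
Proof.
apply: ideal_mul_sub; first by apply: ideal_addP; exact: ideal_mulP.
move=> _ y [u Iu [v Jv <-]] Ky; exists (u * y); first exact: mem_ideal_mul.
by exists (v * y); [exact: mem_ideal_mul|rewrite mulrDl].
Qed.

Lemma ideal_expP I k : ideal (ideal_exp I k).
Proof. by case: k => [|k]; [exact: idealT|exact: ideal_mulP]. Qed.

Lemma ideal_exp0 I : ideal_exp I 0 = setT. Proof. by []. Qed.

Lemma ideal_expS I k : ideal_exp I k.+1 = ideal_mul I (ideal_exp I k).
Proof. by []. Qed.

Lemma ideal_exp1 I : ideal I -> ideal_exp I 1 = I.
Proof. by move=> idI; rewrite ideal_expS ideal_mulC ideal_mulTl. Qed.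

Lemma ideal_expD I j k :
  ideal_exp I (j + k) = ideal_mul (ideal_exp I j) (ideal_exp I k).
Proof.
elim: j => [|j IHj]; first by rewrite ideal_mulTl //; exact: ideal_expP.
by rewrite addSn !ideal_expS IHj ideal_mulA.
Qed.

Lemma ideal_expM I j k : ideal_exp I (j * k) = ideal_exp (ideal_exp I j) k.
Proof.
elim: k => [|k IHk]; first by rewrite muln0.
by rewrite mulnS ideal_expD IHk.
Qed.

Lemma mem_ideal_exp I x k : I x -> ideal_exp I k (x ^+ k).
Proof.
by move=> Ix; elim: k => [//|k IHk]; rewrite exprS ideal_expS; apply: mem_ideal_mul.
Qed.

Lemma ideal_expS_sub I k : ideal_exp I k.+1 `<=` ideal_exp I k.
Proof. by rewrite ideal_expS; apply: ideal_mul_subr; exact: ideal_expP. Qed.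

End Ideals.

(** * Determinants *)

Section Determinants.
Variable R : comNzRingType.
Implicit Types (F G I K P : set R).

Lemma ideal_exp_prod F k (f : 'I_k -> R) :
  (forall i, F (f i)) -> ideal_exp F k (\prod_i f i).
Proof.
elim: k => [|k IHk] in f * => Ff; first by rewrite big_ord0.
by rewrite big_ord_recl; apply: mem_ideal_mul => //; apply: IHk.
Qed.

Lemma prod_congr F G k (f g : 'I_k -> R) : ideal F -> G `<=` F ->
  (forall i, F (f i)) -> (forall i, F (g i)) -> (forall i, G (f i - g i)) ->
  ideal_mul G (ideal_exp F k.-1) (\prod_i f i - \prod_i g i).
Proof.
move=> idF GF; elim: k => [|k IHk] in f g *.
  by move=> *; rewrite !big_ord0 subrr; exact: (ideal0 (ideal_mulP _ _)).
move=> Ff Fg Gfg; rewrite !big_ord_recl /=.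
set p := \prod_(i < k) f _; set q := \prod_(i < k) g _.
have Fp : ideal_exp F k p.
  exact: ideal_exp_prod.
have -> : f ord0 * p - g ord0 * q = (f ord0 - g ord0) * p + g ord0 * (p - q).
  by ring.
apply: (idealD (ideal_mulP _ _)); first exact: mem_ideal_mul.
have := IHk (fun i => f (lift ord0 i)) (fun i => g (lift ord0 i)).
rewrite -/p -/q => /(_ (fun=> Ff _) (fun=> Fg _) (fun=> Gfg _)) Gpq.
have [k0|k_gt0] := posnP k.
  rewrite /p /q !big_pred0; try by move=> i; have := ltn_ord i; rewrite {2}k0.
  by rewrite subrr mulr0; exact: (ideal0 (ideal_mulP _ _)).
have -> : ideal_exp F k = ideal_mul F (ideal_exp F k.-1).
  by rewrite -ideal_expS prednK.
by rewrite ideal_mulA (ideal_mulC G) -ideal_mulA; apply: mem_ideal_mul.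
Qed.

(** Expanding the determinants, every term of the difference has one factor in
    [G] and the others in [F]. *)
Lemma det_congr F G k (A B : 'M[R]_k) : ideal F -> G `<=` F ->
  (forall i j, F (A i j)) -> (forall i j, F (B i j)) ->
  (forall i j, G (A i j - B i j)) ->
  ideal_mul G (ideal_exp F k.-1) (\det A - \det B).
Proof.
move=> idF GF FA FB GAB; rewrite /determinant -sumrB.
apply: (ideal_sum (ideal_mulP _ _)) => s _; rewrite -mulrBr.
by apply: (idealMl (ideal_mulP _ _)); apply: prod_congr.
Qed.

Lemma mul_span_seqP P (s : seq R) x : ideal P ->
  ideal_mul P (ideal_span [set` s]) x ->
  exists c : 'I_(size s) -> R,
    (forall i, P (c i)) /\ x = \sum_(i < size s) c i * s`_i.
Proof.
move=> idP; pose S := [set x | exists c : 'I_(size s) -> R,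
  (forall i, P (c i)) /\ x = \sum_(i < size s) c i * s`_i].
apply: (@ideal_mul_sub _ _ _ S) => [|p y Pp /span_seqP[c ->]].
  apply/idealP; split=> [|a _ _ [c [Pc ->]] [c' [Pc' ->]]].
    exists (fun=> 0); split=> [_|]; first exact: ideal0.
    by rewrite big1 // => i _; rewrite mul0r.
  exists (fun i => a * c i + c' i); split=> [i|].
    by apply: (idealD idP) => //; apply: (idealMl idP).
  by rewrite mulr_sumr -big_split; apply: eq_bigr => i _ /=; ring.
exists (fun i => p * c i); split=> [i|]; first exact: (idealMr idP).
by rewrite mulr_sumr; apply: eq_bigr => i _; ring.
Qed.

Lemma adj_kills k (A : 'M[R]_k) (y : 'cV[R]_k) K :
  ideal K -> (forall i, K ((A *m y) i 0)) -> forall i, K (\det A * y i 0).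
Proof.
move=> idK KAy i.
have -> : \det A * y i 0 = (\adj A *m (A *m y)) i 0.
  by rewrite mulmxA mul_adj_mx mul_scalar_mx !mxE.
by rewrite mxE; apply: (ideal_sum idK) => j _; apply: (idealMl idK).
Qed.

End Determinants.

(** * Primes of Noetherian rings *)

Section Primes.
Variable R : comNzRingType.
Implicit Types (I J K L P : set R).

Lemma primeP P : prime_ideal P <->
  [/\ ideal P, ~ P 1 & forall x y, P (x * y) -> P x \/ P y].
Proof.
split.
- move=> [[P0 P1 Pl] Pm]; split.
  + by apply/idealP; split=> [|a u v Pu Pv]; [move: P0; rewrite inE|
      have := Pl a u v; rewrite !inE; exact].
  + by move: P1; rewrite notin_setE.
  + by move=> x y Pxy; have := Pm x y; rewrite !inE => /(_ Pxy)/orP[];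
      rewrite inE; [left|right].
- move=> [/idealP[P0 Pl] P1 Pm]; split; first split.
  + by rewrite inE.
  + by rewrite notin_setE.
  + by move=> a u v; rewrite !inE; exact: Pl.
  + move=> x y; rewrite !inE => /Pm[]Px; apply/orP; [left|right]; by rewrite inE.
Qed.

Section OnePrime.
Variable P : set R.
Hypothesis pP : prime_ideal P.

Lemma prime_ideal_ideal : ideal P. Proof. by case/primeP: pP. Qed.
Lemma prime1 : ~ P 1. Proof. by case/primeP: pP. Qed.
Lemma primeM x y : ~ P x -> ~ P y -> ~ P (x * y).
Proof. by case/primeP: pP => _ _ Pm Px Py /Pm[]. Qed.
Lemma primeMr x y : P (x * y) -> ~ P x -> P y.
Proof. by case/primeP: pP => _ _ Pm /Pm[]. Qed.
Lemma primeX x k : P (x ^+ k) -> P x.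
Proof.
case/primeP: pP => _ P1 Pm; elim: k => [//|k IHk]; rewrite exprS.
by case/Pm.
Qed.
Lemma prime_prod (T : Type) (s : seq T) (F : T -> R) :
  (forall i, ~ P (F i)) -> ~ P (\prod_(i <- s) F i).
Proof. by move=> nF; elim/big_ind: _ => //; [exact: prime1|exact: primeM]. Qed.

Lemma prime_exp I k : ideal I -> ideal_exp I k `<=` P -> I `<=` P.
Proof. by move=> idI IP x /(mem_ideal_exp k)/IP/primeX. Qed.

(** Nakayama's lemma for the localization at [P], with denominators cleared. *)
Lemma nakayama_prime (s : seq R) K : ideal K ->
  (forall g, g \in s -> exists t, ~ P t /\
     ideal_add K (ideal_mul P (ideal_span [set` s])) (t * g)) ->
  exists t, ~ P t /\ forall g, ideal_span [set` s] g -> K (t * g).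
Proof.
move=> idK hs.
have : forall i : 'I_(size s), exists tc : R * ('I_(size s) -> R),
    [/\ ~ P tc.1, forall j, P (tc.2 j) &
        K (tc.1 * s`_i - \sum_(j < size s) tc.2 j * s`_j)].
  move=> i; have [t [Pt [u Ku [v + tE]]]] := hs s`_i (mem_nth _ (ltn_ord i)).
  move=> /(mul_span_seqP prime_ideal_ideal)[c [Pc vE]].
  by exists (t, c); split=> //=; rewrite -tE vE addrK.
move=> /choice[tc tcP].
pose A := \matrix_(i, j) ((tc i).1 *+ (i == j) - (tc i).2 j).
pose y := \col_(i < size s) s`_i.
exists (\det A); split=> [PA|g].
  pose B := \matrix_(i, j < size s) ((tc i).1 *+ (i == j)).
  have : P (\det A - \det B).
    have : ideal_mul P (ideal_exp setT (size s).-1) (\det A - \det B).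
      apply: det_congr => // [|i j]; first exact: idealT.
      rewrite !mxE addrAC subrr add0r; apply: (idealN prime_ideal_ideal).
      by case: (tcP i).
    exact: (ideal_mul_subl prime_ideal_ideal).
  have -> : \det B = \prod_i (tc i).1.
    have -> : B = diag_mx (\row_i (tc i).1).
      by apply/matrixP => i j; rewrite !mxE.
    by rewrite det_diag; apply: eq_bigr => i _; rewrite mxE.
  move=> PAB; have := idealB prime_ideal_ideal PA PAB.
  rewrite opprB addrC subrK; apply: prime_prod => i; by case: (tcP i).
case/span_seqP=> c ->; rewrite mulr_sumr; apply: (ideal_sum idK) => i _.
rewrite mulrCA; apply: (idealMl idK).
have -> : s`_i = y i 0 by rewrite mxE.
apply: adj_kills => // j; have [_ _] := tcP j.
rewrite [in X in _ -> X]mxE; congr K; symmetry.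
transitivity (\sum_k ((tc j).1 *+ (j == k) * s`_k - (tc j).2 k * s`_k)).
  by apply: eq_bigr => k _; rewrite !mxE mulrBl.
rewrite sumrB; congr (_ - _); rewrite (bigD1 j) //= eqxx big1 ?addr0 // => k.
by rewrite eq_sym => /negPf ->; rewrite mul0r.
Qed.

End OnePrime.
End Primes.

Section Noetherian.
Variable R : comNzRingType.
Hypothesis noethR : noetherian R.
Implicit Types (I J K L P : set R).

Lemma span1P (x y : R) : ideal_span [set x] y <-> exists a, y = a * x.
Proof.
split=> [|[a ->]]; last first.
  by apply: (idealMl (ideal_spanP _)); exact: sub_span.
apply: (@span_sub _ _ [set y | exists a, y = a * x]) => [|_ ->]; last first.
  by exists 1; rewrite mul1r.
apply/idealP; split=> [|a _ _ [u ->] [v ->]]; first by exists 0; rewrite mul0r.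
by exists (a * u + v); ring.
Qed.

Lemma noetherian_max (F : set (set R)) :
  (forall I, F I -> ideal I) -> F !=set0 ->
  exists M, F M /\ forall I, F I -> M `<=` I -> I `<=` M.
Proof.
move=> idF [I0 FI0]; apply: contrapT => noM.
have step (A : {I | F I}) : exists B : {I | F I},
    sval A `<=` sval B /\ ~ sval B `<=` sval A.
  apply: contrapT => noB; apply: noM; exists (sval A); split; first exact: svalP.
  move=> I FI AI; apply: contrapT => IA; apply: noB.
  by exists (exist _ I FI).
have [nxt nxtP] := choice step.
pose X n := iter n nxt (exist _ I0 FI0).
have idX n : ideal (sval (X n)) by apply: idF; exact: svalP.
have Xmono i j : (i <= j)%N -> sval (X i) `<=` sval (X j).
  move=> /subnK <-; elim: (j - i)%N => [//|k IHk] x /IHk Xx.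
  by rewrite addSn; apply: (nxtP _).1.
pose U : set R := [set x | exists n, sval (X n) x].
have idU : ideal U.
  apply/idealP; split=> [|a u v [i Xu] [j Xv]]; first by exists 0%N; exact: ideal0.
  exists (maxn i j); apply: (idealD (idX _)).
    by apply: (idealMl (idX _)); apply: Xmono Xu; rewrite leq_maxl.
  by apply: Xmono Xv; rewrite leq_maxr.
have [s Us] := noethR idU.
have [n sXn] : exists n, forall g, g \in s -> sval (X n) g.
  have : forall g, g \in s -> U g by move=> g gs; rewrite Us; exact: sub_span.
  elim: (s) => [|g t IHt] sU; first by exists 0%N.
  have [|i tX] := IHt; first by move=> h ht; apply: sU; rewrite inE ht orbT.
  have [j gX] := sU g (mem_head _ _).
  exists (maxn i j) => h; rewrite inE => /orP[/eqP ->|/tX hX].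
    by apply: Xmono gX; rewrite leq_maxr.
  by apply: Xmono hX; rewrite leq_maxl.
apply: (nxtP (X n)).2 => x Xx.
have : U x by exists n.+1.
by rewrite Us; apply: span_sub.
Qed.

(** An ideal that is maximal among those avoiding [S] is prime. *)
Lemma prime_avoiding (S : set R) J : ideal J ->
  S 1 -> (forall x y, S x -> S y -> S (x * y)) -> (forall x, S x -> ~ J x) ->
  exists P, [/\ prime_ideal P, J `<=` P & forall x, S x -> ~ P x].
Proof.
move=> idJ S1 SM SJ.
have [||M [[idM JM SM'] Mmax]] :=
    @noetherian_max [set I | [/\ ideal I, J `<=` I & forall x, S x -> ~ I x]].
- by move=> I [].
- by exists J; split.
exists M; split=> //; apply/primeP; split=> // [|x y Mxy]; first exact: SM'.
apply: contrapT => /not_orP[nMx nMy].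
have meet z : ~ M z -> exists a u, M u /\ S (u + a * z).
  move=> nMz; apply: contrapT => no; apply: nMz.
  pose I := ideal_add M (ideal_span [set z]).
  have idI : ideal I by apply: ideal_addP => //; exact: ideal_spanP.
  apply: (Mmax I); last by apply: ideal_addr => //; exact: sub_span.
    split=> // [w /JM Mw|w Sw [u Mu [v /span1P[a ->] uvw]]].
      by apply: ideal_addl => //; exact: ideal_spanP.
    by apply: no; exists a, u; rewrite uvw.
  by apply: ideal_addl; exact: ideal_spanP.
have [a [u [Mu Su]]] := meet x nMx.
have [b [v [Mv Sv]]] := meet y nMy.
apply: (SM' _ (SM _ _ Su Sv)).
have -> : (u + a * x) * (v + b * y) = (v + b * y) * u + (a * x) * v + (a * b) * (x * y).
  by ring.
by apply: (idealD idM); [apply: (idealD idM)|]; apply: (idealMl idM).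
Qed.

(** ** Krull's principal ideal theorem *)

(** The contraction of the extension of [J] to the localization at [P]; working
    with such ideals replaces localizing the ring. *)
Definition saturation P J : set R := [set r | exists t, ~ P t /\ J (t * r)].

Definition saturated P J := forall t r, ~ P t -> J (t * r) -> J r.

Lemma saturation_ideal P J : prime_ideal P -> ideal J -> ideal (saturation P J).
Proof.
move=> pP idJ; apply/idealP; split.
  by exists 1; split; [exact: prime1|rewrite mulr0; exact: ideal0].
move=> a u v [t [Pt Jt]] [t' [Pt' Jt']]; exists (t * t'); split.
  exact: primeM.
have -> : t * t' * (a * u + v) = (t' * a) * (t * u) + t * (t' * v) by ring.
by apply: (idealD idJ); apply: (idealMl idJ).
Qed.

Lemma saturation_saturated P J : prime_ideal P -> saturated P (saturation P J).
Proof.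
move=> pP t r Pt [t' [Pt' Jt']]; exists (t' * t); split; first exact: primeM.
by rewrite -mulrA.
Qed.

Lemma sub_saturation P J : prime_ideal P -> J `<=` saturation P J.
Proof. by move=> pP x Jx; exists 1; split; [exact: prime1|rewrite mul1r]. Qed.

Lemma saturation_sub P J K : saturated P K -> J `<=` K -> saturation P J `<=` K.
Proof. by move=> satK JK x [t [Pt /JK]]; exact: satK. Qed.

(** By Noetherian induction on a common lower bound of the chain. Adjoining to it
    an element that [P] kills modulo it adds a simple subquotient to the
    localization at [P], and a descending chain crosses this only once. *)
Lemma saturated_dcc P J0 (C : nat -> set R) :
  prime_ideal P ->
  (forall p, P p -> exists k t, ~ P t /\ J0 (t * p ^+ k)) ->
  (forall n, [/\ ideal (C n), saturated P (C n) & J0 `<=` C n]) ->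
  (forall n, C n.+1 `<=` C n) ->
  exists n, forall k, C n `<=` C (n + k)%N.
Proof.
move=> pP nilP C_ Cdec.
pose good J := forall C : nat -> set R,
  (forall n, [/\ ideal (C n), saturated P (C n) & J `<=` C n]) ->
  (forall n, C n.+1 `<=` C n) -> exists n, forall k, C n `<=` C (n + k)%N.
have decS (D : nat -> set R) : (forall n, D n.+1 `<=` D n) ->
    forall n k, D (n + k)%N `<=` D n.
  by move=> Ddec n; elim=> [|k IHk] x; rewrite ?addn0// addnS => /Ddec/IHk.
suff goodJ J : ideal J -> saturated P J -> J0 `<=` J -> good J.
  pose J := \bigcap_(n in setT) C n.
  apply: (goodJ J) => // [|t r Pt Jtr n _|x J0x n _|n].
  - by apply: ideal_bigcap => n _; case: (C_ n).
  - by case: (C_ n) => _ satC _; apply: (satC t) => //; exact: Jtr.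
  - by case: (C_ n) => _ _; exact.
  by case: (C_ n) => idC satC _; split=> // x; exact.
move=> idJ satJ J0J; apply: contrapT => badJ.
have [||M [[idM satM J0M badM] Mmax]] := @noetherian_max
    [set J | [/\ ideal J, saturated P J, J0 `<=` J & ~ good J]].
- by move=> I [].
- by exists J; split.
apply: badM => D D_ Ddec.
have [M1|nM1] := pselect (M 1).
  exists 0%N => k x _; case: (D_ (0 + k)%N) => idD _ MD.
  by rewrite (ideal_full idD) //; exact: MD.
have [||A [[z Mz AE] Amax]] := @noetherian_max
    [set A | exists2 z, ~ M z & A = [set r | M (r * z)]].
- move=> _ [z _ ->]; apply/idealP; split=> [|a u v /= Mu Mv].
    by rewrite /= mul0r; exact: ideal0.
  have -> : (a * u + v) * z = a * (u * z) + v * z by ring.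
  by apply: (idealD idM) => //; apply: (idealMl idM).
- by exists [set r | M (r * 1)]; exists 1.
have Pz p : P p -> M (p * z).
  move=> Pp.
  have Aprime k : M (p ^+ k * z) -> M (p * z).
    elim: k => [|k IHk] Mk; first by rewrite expr0 mul1r in Mk.
    have [//|nMpz] := pselect (M (p * z)).
    have : A (p ^+ k).
      apply: (Amax [set r | M (r * (p * z))]).
      - by exists (p * z).
      - move=> r; rewrite AE /= => Mrz.
        by have -> : r * (p * z) = p * (r * z) by [ring]; apply: (idealMl idM).
      by rewrite /= mulrA -exprSr.
    by rewrite AE => /IHk.
  have [k [t [Pt J0t]]] := nilP p Pp.
  apply: (Aprime k); apply: (idealMr idM); apply: (satM t) => //; exact: J0M.
pose M' := saturation P (ideal_add M (ideal_span [set z])).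
have idMz : ideal (ideal_add M (ideal_span [set z])).
  by apply: ideal_addP => //; exact: ideal_spanP.
have MM' : M `<=` M'.
  by move=> x Mx; apply: sub_saturation => //; apply: ideal_addl => //; exact: ideal_spanP.
have idM' : ideal M' by exact: saturation_ideal.
have satM' : saturated P M' by exact: saturation_saturated.
have M'z : M' z.
  by apply: sub_saturation => //; apply: ideal_addr => //; exact: sub_span.
have goodM' : good M'.
  apply: contrapT => badM'; apply: Mz; apply: (Mmax M') => //.
  by split=> // x /J0M/MM'.
have [Dz|] := pselect (forall n, D n z).
  apply: goodM' => // n; case: (D_ n) => idD satD MD; split=> //.
  apply: saturation_sub => //; apply: ideal_add_sub => //.
  by apply: span_sub => // _ ->.
move=> /existsNP[n0 nDz].
pose E n := saturation P (ideal_add (D n) M').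
have idDM' n : ideal (ideal_add (D n) M').
  by apply: ideal_addP => //; case: (D_ n).
have [||n1 En1] := goodM' E.
- move=> n; split; [exact: saturation_ideal|exact: saturation_saturated|].
  move=> x M'x; apply: sub_saturation => //; apply: ideal_addr => //.
  by case: (D_ n).
- move=> n x [t [Pt [u Du [v M'v uv]]]]; exists t; split=> //.
  by exists u; [exact: Ddec|exists v].
have DM'M n y : (n0 <= n)%N -> D n y -> M' y -> M y.
  move=> n0n Dy [t [Pt [u Mu [_ /span1P[a ->] uv]]]].
  have [idD satD MD] := D_ n.
  apply: (satM t) => //; rewrite -uv; apply: (idealD idM) => //.
  apply: Pz; apply: contrapT => nPa; apply: nDz.
  have : D n z.
    apply: (satD a) => //.
    by rewrite -[a * z](addKr u) uv; apply: (idealD idD);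
      [apply: (idealN idD); exact: MD|apply: (idealMl idD)].
  by rewrite -(subnKC n0n); exact: decS.
exists (maxn n0 n1) => k x Dx; set n := maxn n0 n1 in Dx *.
have : E (n + k)%N x.
  have -> : (n + k)%N = (n1 + (n - n1 + k))%N.
    by rewrite addnA subnKC // leq_maxr.
  apply: En1; apply: (decS E) (n - n1)%N _ _.
    move=> j y [t [Pt [u Du [v M'v uv]]]]; exists t; split=> //.
    by exists u; [exact: Ddec|exists v].
  rewrite subnKC ?leq_maxr //; apply: sub_saturation => //; exact: ideal_addl.
move=> [t [Pt [u Du [v M'v uv]]]].
have [idD satD MD] := D_ (n + k)%N.
apply: (satD t) => //; rewrite -uv; apply: (idealD idD) => //; apply: MD.
apply: (DM'M n) => //; first exact: leq_maxl.
have [idDn _ _] := D_ n.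
rewrite -[v](addKr u) uv; apply: (idealD idDn); last exact: (idealMl idDn).
by apply: (idealN idDn); exact: decS Du.
Qed.


(** If no prime lies properly between [P0] and [P2] and contains [x], then [P2]
    is minimal over [P0 + (x)]. By the descending chain condition the symbolic
    powers of [P1] agree modulo [x] from some point on, hence agree by
    Nakayama's lemma at [P2], and Nakayama's lemma at [P1] then puts a power of
    [P1] in [P0]. *)
Lemma krull_principal P0 P1 P2 (x : R) :
  prime_ideal P0 -> prime_ideal P1 -> prime_ideal P2 ->
  P0 `<` P1 -> P1 `<` P2 -> P2 x ->
  exists P, [/\ prime_ideal P, P0 `<` P, P `<` P2 & P x].
Proof.
move=> pP0 pP1 pP2 [P01 P10] [P12 P21] P2x.
have [P1x|nP1x] := pselect (P1 x); first by exists P1.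
apply: contrapT => noP.
have id0 := prime_ideal_ideal pP0.
pose J0 := ideal_add P0 (ideal_span [set x]).
have idJ0 : ideal J0 by apply: ideal_addP => //; exact: ideal_spanP.
have J0x : J0 x by apply: ideal_addr => //; exact: sub_span.
have P0J0 : P0 `<=` J0 by apply: ideal_addl; exact: ideal_spanP.
have nil2 p : P2 p -> exists k t, ~ P2 t /\ J0 (t * p ^+ k).
  move=> P2p; apply: contrapT => no.
  have [|||P [pP J0P avP]] := @prime_avoiding
      [set s | exists k t, ~ P2 t /\ s = t * p ^+ k] J0 idJ0.
  - by exists 0%N, 1; split; [exact: prime1|rewrite mulr1].
  - move=> _ _ [k [t [Pt ->]]] [k' [t' [Pt' ->]]].
    by exists (k + k')%N, (t * t'); split; [exact: primeM|rewrite exprD; ring].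
  - by move=> _ [k [t [Pt ->]]] J0tp; apply: no; exists k, t.
  apply: noP; exists P; split=> //; last exact: J0P.
    split; first by move=> y /P0J0/J0P.
    by move=> /(_ x (J0P _ J0x))/P01.
  split=> [s Ps|/(_ p P2p)].
    apply: contrapT => nP2s; apply: (avP s) => //; exists 0%N, s.
    by rewrite mulr1.
  by apply: avP; exists 1%N, 1; split; [exact: prime1|rewrite expr1 mul1r].
pose S n := saturation P1 (ideal_add (ideal_exp P1 n) P0).
have idS' n : ideal (ideal_add (ideal_exp P1 n) P0).
  by apply: ideal_addP => //; exact: ideal_expP.
have idS n : ideal (S n) by exact: saturation_ideal.
have satS n : saturated P1 (S n) by exact: saturation_saturated.
have P0S n : P0 `<=` S n.
  by move=> y P0y; apply: sub_saturation => //; apply: ideal_addr => //; exact: ideal_expP.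
have decS n : S n.+1 `<=` S n.
  move=> y [t [Pt [u Eu [v P0v uv]]]]; exists t; split=> //.
  by exists u; [exact: ideal_expS_sub|exists v].
pose C n := saturation P2 (ideal_add (S n) (ideal_span [set x])).
have idC' n : ideal (ideal_add (S n) (ideal_span [set x])).
  by apply: ideal_addP => //; exact: ideal_spanP.
have [||n Cn] := @saturated_dcc P2 J0 C pP2 nil2.
- move=> n; split; [exact: saturation_ideal|exact: saturation_saturated|].
  move=> y [u P0u [v xv <-]]; apply: sub_saturation => //.
  by exists u; [exact: P0S|exists v].
- move=> n y [t [Pt [u Su [v xv uv]]]]; exists t; split=> //.
  by exists u; [exact: decS|exists v].
have SS : S n `<=` S n.+1.
  have [s sE] := noethR (idS n).
  have [|t [P2t tS]] := @nakayama_prime _ P2 pP2 s (S n.+1) (idS n.+1).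
    rewrite -sE => g gs.
    have Sg : S n g by rewrite sE; exact: sub_span.
    have /(Cn 1%N) : C n g by apply: sub_saturation => //; apply: ideal_addl => //; exact: ideal_spanP.
    rewrite addn1 => -[t [P2t [q Sq [_ /span1P[a ->] qa]]]]; exists t; split=> //.
    exists q => //; exists (a * x) => //; rewrite mulrC.
    apply: mem_ideal_mul => //; apply: (satS n x) => //.
    rewrite mulrC -[a * x](addKr q) qa; apply: (idealD (idS n)).
      by apply: (idealN (idS n)); exact: decS.
    exact: (idealMl (idS n)).
  move=> g Sg; apply: (satS n.+1 t); first by move=> /P12.
  by apply: tS; rewrite -sE.
have [s sE] := noethR (ideal_expP P1 n).
have [|t [P1t tP]] := @nakayama_prime _ P1 pP1 s P0 id0.
  rewrite -sE => g gs.
  have Eg : ideal_exp P1 n g by rewrite sE; exact: sub_span.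
  have /SS : S n g by apply: sub_saturation => //; exact: ideal_addl.
  move=> [t [P1t [u Eu [v P0v uv]]]]; exists t; split=> //.
  by exists v => //; exists u; rewrite ?uv // addrC.
apply: P10; apply: (@prime_exp _ P0 pP0 P1 n (prime_ideal_ideal pP1)) => g Eg.
by apply: (primeMr pP0 (x := t)); [apply: tP; rewrite -sE|move=> /P01].
Qed.

(** Only the first [h.+1] terms matter; a sequence indexed by all numbers can be
    shortened or extended without changing its type. *)
Definition prime_chain (P : nat -> set R) (h : nat) :=
  (forall i, (i <= h)%N -> prime_ideal (P i)) /\
  forall i, (i < h)%N -> P i `<` P i.+1.

(** The chain is modified from the top: whenever [x] lies in the last prime but
    not in the previous one, [krull_principal] replaces the latter. *)
Lemma prime_chain_through (P : nat -> set R) h (x : R) : prime_chain P h.+1 -> P h.+1 x ->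
  exists P' : nat -> set R, [/\ prime_chain P' h, P 0%N `<=` P' 0%N, P' 0%N x & P' h = P h.+1].
Proof.
elim: h => [|h IHh] in P *.
  move=> [pP cP] P1x; exists (fun=> P 1%N); split=> //; last by case: (cP 0%N).
  by split=> // i _; exact: pP.
move=> [pP cP] Px.
have [P' [pP' PP' P'P P'x]] := krull_principal (pP h (leqW (leqnSn h)))
  (pP h.+1 (leqnSn _)) (pP h.+2 (leqnn _)) (cP h (leqnSn _)) (cP h.+1 (leqnn _)) Px.
have [||Q [[pQ cQ] PQ Qx Qh]] := IHh (fun i => if (i <= h)%N then P i else P').
- split=> i; rewrite leq_eqVlt => /orP[/eqP|]; rewrite ?ltnS.
  + by move->; rewrite ltnn.
  + by move=> ih; rewrite ih; apply: pP; rewrite (leq_trans ih) // leqW // leqW.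
  + by case=> ->; rewrite leqnn ltnn.
  + by move=> ih; rewrite (ltnW ih) ih; apply: cP; rewrite (leq_trans ih) // leqW.
- by rewrite ltnn.
rewrite /= in PQ; rewrite ltnn in Qh.
exists (fun i => if (i <= h)%N then Q i else P h.+2); split=> //; last by rewrite ltnn.
split=> i; rewrite leq_eqVlt => /orP[/eqP|]; rewrite ?ltnS.
- by move->; rewrite ltnn; exact: pP.
- by move=> ih; rewrite ih; exact: pQ.
- by case=> ->; rewrite leqnn ltnn Qh.
- by move=> ih; rewrite (ltnW ih) ih; exact: cQ.
Qed.

(** A chain that passes through one of the [b] is one step shorter; after all of
    them are used up a step is still left, and its lower end is the prime. *)
Lemma krull_height (P : nat -> set R) h (b : seq R) : prime_chain P h -> (size b < h)%N ->
  (forall x, x \in b -> P h x) ->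
  exists P', [/\ prime_ideal P', P 0%N `<=` P', P' `<` P h &
                 forall x, x \in b -> P' x].
Proof.
elim: b => [|x b IHb] in P h *.
  move=> [pP cP] h_gt0 _; exists (P 0%N); split=> //; first exact: pP.
  case: h => [//|h] in h_gt0 pP cP *.
  elim: h => [|h IHh] in h_gt0 pP cP *; first exact: cP.
  have [//|i ih|i ih|P0 nP0] := IHh.
  - by apply: pP; rewrite leqW.
  - by apply: cP; rewrite leqW.
  have [Ph nPh] := cP h.+1 (leqnn _).
  by split=> [y /P0/Ph|PP]; [|apply: nPh => y /PP/P0].
case: h => [//|h] /= cP bh bP.
have [|P' [cP' PP' P'x P'h]] := prime_chain_through cP (x := x).
  by apply: bP; exact: mem_head.
have [//|y yb|Q [pQ P'Q QP Qb]] := IHb P' h cP'.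
  by rewrite P'h; apply: bP; rewrite inE yb orbT.
exists Q; split=> //; [by move=> y /PP'/P'Q|by rewrite -P'h|].
by move=> y; rewrite inE => /orP[/eqP ->|/Qb//]; exact: P'Q.
Qed.

End Noetherian.

(** * Noetherian local rings *)

Section LocalRing.
Variables (R : comNzRingType) (m : idealr R).
Hypothesis noethR : noetherian R.
Hypothesis localR : local_ring m.
Implicit Types (I J K L P : set R).

Let M : set R := [set` m].

Lemma local_ideal : ideal M.
Proof.
have [+ _] := (localR M).2 erefl; case=> M0 M1 Ml; apply/idealP; split.
  by move: M0; rewrite inE.
by move=> a u v Mu Mv; have := Ml a u v; rewrite !inE; exact.
Qed.

Lemma local1 : ~ M 1.
Proof. by have [[_ + _] _] := (localR M).2 erefl; rewrite notin_setE. Qed.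

Lemma local_sub I : ideal I -> ~ I 1 -> I `<=` M.
Proof.
move=> idI nI1.
have [||N [[idN nN1] Nmax]] := noetherian_max noethR
    (F := [set J | ideal J /\ ~ J 1 /\ I `<=` J]).
- by move=> J [].
- by exists I; split => //; split.
case: nN1 => nN1 IN; suff -> : M = N by [].
symmetry; apply/localR; split.
  have /idealP[N0 Nl] := idN; split; rewrite ?inE ?notin_setE //.
  by move=> a u v; rewrite !inE; exact: Nl.
move=> J [J0 J1 Jl] NJ; apply/seteqP; split=> //; apply: Nmax => //.
split; last by split; [rewrite -notin_setE|move=> x /IN/NJ].
by apply/idealP; split=> [|a u v Ju Jv]; [move: J0; rewrite inE|
   have := Jl a u v; rewrite !inE; exact].
Qed.

Lemma local_unit u : ~ M u -> exists v, v * u = 1.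
Proof.
move=> nMu; apply: contrapT => nv; apply: nMu.
apply: (local_sub (ideal_spanP [set u])); last exact: sub_span.
by move=> /span1P[v uv]; apply: nv; exists v.
Qed.

Lemma local_prime : prime_ideal M.
Proof.
apply/primeP; split; [exact: local_ideal|exact: local1|move=> x y Mxy].
apply: contrapT => /not_orP[/local_unit[v vx] nMy]; apply: nMy.
by rewrite -[y]mul1r -vx -mulrA; apply: (idealMl local_ideal).
Qed.

Lemma nakayama_local J K : ideal J -> ideal K ->
  J `<=` ideal_add K (ideal_mul M J) -> J `<=` K.
Proof.
move=> idJ idK JKM; have [s sE] := noethR idJ.
have [|t [Mt tJ]] := nakayama_prime local_prime (s := s) idK.
  move=> g gs; exists 1; split; first exact: local1.
  by rewrite mul1r -sE; apply: JKM; rewrite sE; exact: sub_span.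
have [v vt] := local_unit Mt.
move=> x Jx; rewrite -[x]mul1r -vt -mulrA; apply: (idealMl idK).
by apply: tJ; rewrite -sE.
Qed.

(** In dimension [d] the maximal ideal is not minimal over fewer than [d]
    elements. If the given chain of primes stops below the maximal ideal, it is
    extended by it. *)
Lemma local_dim_avoid d (b : seq R) : krull_dim R d -> (size b < d)%N ->
  (forall x, x \in b -> M x) ->
  exists P, [/\ prime_ideal P, P `<=` M, ~ M `<=` P & forall x, x \in b -> P x].
Proof.
move=> [[X [pX X_mono]] _] bd bM.
pose P i := if (i <= d)%N then X (inord i) else M.
have cP : prime_chain P d.
  split=> i id; rewrite /P.
    by rewrite id; exact: pX.
  rewrite (ltnW id) id; apply: X_mono.
  by rewrite !inordK // ltnS // ltnW.
have PM : P d `<=` M.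
  have /primeP[idX nX1 _] := cP.1 d (leqnn d).
  exact: local_sub.
have [MP|nMP] := pselect (M `<=` P d).
  have [|Q [pQ _ [QP nPQ] Qb]] := krull_height noethR cP bd.
    by move=> x /bM/MP.
  by exists Q; split=> // [x /QP/PM|MQ]; [|apply: nPQ => x /PM/MQ].
have cP' : prime_chain P d.+1.
  split=> i; rewrite leq_eqVlt => /orP[/eqP|]; rewrite ?ltnS.
  - by move->; rewrite /P ltnn; exact: local_prime.
  - exact: cP.1.
  - by case=> ->; rewrite {2}/P ltnn.
  - exact: cP.2.
have PdM : P d.+1 = M by rewrite /P ltnn.
have [||Q [pQ _ [QP nPQ] Qb]] := krull_height noethR cP' (b := b).
- exact: ltnW.
- by rewrite PdM.
by rewrite PdM in QP nPQ; exists Q; split.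
Qed.

End LocalRing.

(** * Matrices of relations *)

Section RelationMatrices.
Variables (R : comNzRingType) (k : nat) (y : 'cV[R]_k).
Implicit Types (u v w : 'rV[R]_k) (A B : 'M[R]_k).

Definition dot u : R := (u *m y) 0 0.

Lemma dotE u : dot u = \sum_j u 0 j * y j 0. Proof. by rewrite /dot mxE. Qed.

Lemma dot_lin a u v : dot (a *: u + v) = a * dot u + dot v.
Proof. by rewrite /dot mulmxDl -scalemxAl !mxE. Qed.

Lemma dotZ a u : dot (a *: u) = a * dot u.
Proof. by rewrite /dot -scalemxAl mxE. Qed.

Lemma dotB u v : dot (u - v) = dot u - dot v.
Proof. by rewrite /dot mulmxBl !mxE. Qed.

Lemma dot0P u : (dot u = 0) <-> (u *m y = 0).
Proof.
by split=> [u0|u0]; [apply/matrixP=> i j; rewrite !ord1 [LHS]u0 mxE|rewrite /dot u0 mxE].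
Qed.

Lemma dot_delta j : dot (delta_mx 0 j) = y j 0.
Proof. by rewrite /dot -rowE mxE. Qed.

Lemma mulmx_dot p (A : 'M[R]_(p, k)) i : (A *m y) i 0 = dot (row i A).
Proof. by rewrite /dot -row_mul [RHS]mxE. Qed.

Definition set_row A i u : 'M[R]_k :=
  \matrix_(p, q) if p == i then u 0 q else A p q.

Lemma row_set_row A i u : row i (set_row A i u) = u.
Proof. by apply/rowP => q; rewrite !mxE eqxx. Qed.

Lemma row_set_row_neq A i j u : j != i -> row j (set_row A i u) = row j A.
Proof. by move=> /negPf ji; apply/rowP => q; rewrite !mxE ji. Qed.

Lemma row'_set_row A i u : row' i (set_row A i u) = row' i A.
Proof. by apply/matrixP => p q; rewrite !mxE eq_sym (negPf (neq_lift _ _)). Qed.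

Lemma cofactor_set_row A i u j : cofactor (set_row A i u) i j = cofactor A i j.
Proof.
rewrite /cofactor; congr (_ * \det _).
by apply/matrixP => p q; rewrite !mxE eq_sym (negPf (neq_lift _ _)).
Qed.

(** Cramer's rule for the matrix whose row [i] is replaced by a unit vector, which
    has the same cofactors along that row. *)
Lemma cofactor_kills A i p q : (forall j, j != i -> dot (row j A) = 0) ->
  cofactor A i p * y q 0 = cofactor A i q * y p 0.
Proof.
move=> Ay; pose W := set_row A i (delta_mx 0 p).
have detW : \det W = cofactor A i p.
  rewrite (expand_det_row W i) (bigD1 p) //= big1 ?addr0.
    by rewrite !mxE !eqxx cofactor_set_row mul1r.
  by move=> j /negPf jp; rewrite !mxE !eqxx /= jp mul0r.
have := congr1 (fun C => (C *m y) q 0) (mul_adj_mx W).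
rewrite -mulmxA mul_scalar_mx [X in _ = X -> _]mxE detW => <-.
rewrite mxE (bigD1 i) //= big1 ?addr0 => [|j ji].
  by rewrite mxE cofactor_set_row mulmx_dot row_set_row dot_delta.
by rewrite mulmx_dot row_set_row_neq // Ay // mulr0.
Qed.

(** The rows that can be subtracted from a row of a square matrix of relations
    on [y] without changing the determinant. Describing them by this effect,
    rather than as combinations of Koszul relations, makes them visibly closed
    under linear combinations. *)
Definition null_row v := dot v = 0 /\
  forall A i, (forall j, j != i -> dot (row j A) = 0) -> row i A = v -> \det A = 0.

Lemma null_row_lin a u v : null_row u -> null_row v -> null_row (a *: u + v).
Proof.
move=> [u0 nu] [v0 nv]; split=> [|A i Ay Ai].
  by rewrite dot_lin u0 v0 mulr0 addr0.
have detu : \det (set_row A i u) = 0.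
  by apply: (nu _ i); rewrite ?row_set_row// => j ji; rewrite row_set_row_neq ?Ay.
have detv : \det (set_row A i v) = 0.
  by apply: (nv _ i); rewrite ?row_set_row// => j ji; rewrite row_set_row_neq ?Ay.
rewrite (@determinant_multilinear _ _ A (set_row A i u) (set_row A i v) i a 1).
- by rewrite detu detv !mulr0 addr0.
- by rewrite !row_set_row scale1r.
- by rewrite row'_set_row.
- by rewrite row'_set_row.
Qed.

Lemma null_row0 : null_row 0.
Proof.
split=> [|A i _ Ai]; first by rewrite /dot mul0mx mxE.
rewrite (expand_det_row A i) big1 // => j _.
by have /rowP/(_ j) := Ai; rewrite !mxE => ->; rewrite mul0r.
Qed.

Lemma null_rowZ a u : null_row u -> null_row (a *: u).
Proof. by move=> nu; rewrite -[_ *: _]addr0; apply: null_row_lin => //; exact: null_row0. Qed.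

Lemma null_rowD u v : null_row u -> null_row v -> null_row (u + v).
Proof. by move=> nu nv; rewrite -[u]scale1r; exact: null_row_lin. Qed.

Lemma null_row_sum (T : Type) (s : seq T) (F : T -> 'rV[R]_k) :
  (forall i, null_row (F i)) -> null_row (\sum_(i <- s) F i).
Proof. by move=> nF; elim/big_ind: _ => //; [exact: null_row0|exact: null_rowD]. Qed.

(** The determinant is a combination of the entries of row [i] whose coefficients,
    the cofactors, satisfy the same proportions as the entries of [y]. *)
Lemma null_row_koszul u v : null_row (dot u *: v - dot v *: u).
Proof.
split=> [|A i Ay Ai].
  by rewrite -scaleNr dot_lin dotZ; ring.
rewrite (expand_det_row A i).
transitivity (\sum_j (dot u * (v 0 j * cofactor A i j) - dot v * (u 0 j * cofactor A i j))).
  apply: eq_bigr => j _; have /rowP/(_ j) := Ai; rewrite !mxE => ->; ring.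
rewrite sumrB -!mulr_sumr !dotE !mulr_suml -sumrB.
transitivity (\sum_p \sum_q (u 0 p * v 0 q * (cofactor A i q * y p 0)
                           - u 0 q * v 0 p * (cofactor A i q * y p 0))).
  apply: eq_bigr => p _; rewrite !mulr_sumr -sumrB; apply: eq_bigr => q _; ring.
rewrite (eq_bigr _ (fun p _ => sumrB _ _ _ _)) sumrB.
rewrite [X in _ - X]exchange_big /= -sumrB big1 // => p _.
rewrite -sumrB big1 // => q _.
by rewrite (cofactor_kills q p Ay) subrr.
Qed.

(** The rows are replaced one at a time, and all the intermediate matrices kill
    [y]. *)
Lemma det_null_rows A B : A *m y = 0 ->
  (forall i, null_row (row i A - row i B)) -> \det A = \det B.
Proof.
move=> Ay nAB.
have dotA i : dot (row i A) = 0 by apply/dot0P; rewrite -row_mul Ay row0.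
have dotB i : dot (row i B) = 0.
  have [+ _] := nAB i; rewrite dotB dotA sub0r => /eqP.
  by rewrite oppr_eq0 => /eqP.
pose H (j : nat) : 'M[R]_k := \matrix_(p, q) if (p < j)%N then B p q else A p q.
have <- : H 0%N = A by apply/matrixP => p q; rewrite !mxE.
have <- : H k = B by apply/matrixP => p q; rewrite !mxE ltn_ord.
suff HE j : (j <= k)%N -> \det (H 0%N) = \det (H j) by exact: HE.
elim: j => [//|j IHj] jk; rewrite (IHj (ltnW jk)).
pose i := Ordinal jk.
have rowH l p : dot (row p (H l)) = 0.
  have -> : row p (H l) = if (p < l)%N then row p B else row p A.
    by apply/rowP => q; rewrite !mxE; case: ifP; rewrite mxE.
  by case: ifP.
have detC : \det (set_row (H j) i (row i A - row i B)) = 0.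
  apply: ((nAB i).2 _ i); rewrite ?row_set_row // => p pi.
  by rewrite row_set_row_neq.
rewrite (@determinant_multilinear _ _ (H j) (H j.+1)
  (set_row (H j) i (row i A - row i B)) i 1 1).
- by rewrite detC mulr0 addr0 mul1r.
- rewrite row_set_row !scale1r; apply/rowP => q.
  by rewrite !mxE /= ltnn leqnn addrC subrK.
- apply/matrixP => p q; rewrite !mxE; set l := lift i p.
  have : l != i by rewrite eq_sym neq_lift.
  by rewrite -val_eqE /= ltnS leq_eqVlt => /negPf ->.
- by rewrite row'_set_row.
Qed.

Lemma det_null_span A B : A *m y = 0 -> \det B = 0 ->
  (forall i, exists w, null_row (row i A - w *m B)) -> \det A = 0.
Proof.
move=> Ay B0 /choice[w wP].
rewrite (@det_null_rows A (\matrix_i w i *m B)) //.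
  by rewrite det_mulmx B0 mulr0.
by move=> i; rewrite row_mul rowK.
Qed.

End RelationMatrices.

(** Sylvester's identity. The power of [t] is cancelled for an indeterminate,
    which is a regular element. *)
Lemma det_sylvester (R : comNzRingType) k d (P : 'M[R]_(k, d)) (Q : 'M[R]_(d, k)) t :
  (d <= k)%N -> \det (t%:M - P *m Q) = t ^+ (k - d) * \det (t%:M - Q *m P).
Proof.
have syl (S : comNzRingType) (A : 'M[S]_(k, d)) (B : 'M[S]_(d, k)) (x : S) :
    x ^+ d * \det (x%:M - A *m B) = x ^+ k * \det (x%:M - B *m A).
  pose U := block_mx x%:M A B (1%:M : 'M_d).
  have detU : \det U = \det (x%:M - A *m B).
    have := det_mulmx U (block_mx 1%:M 0 (- B) 1%:M).
    rewrite det_lblock !det1 !mulr1 => <-.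
    rewrite mulmx_block !mulmx1 !mulmx0 !mul1mx !mulmxN !add0r addrN.
    by rewrite det_ublock det1 mulr1.
  have := det_mulmx (block_mx (1%:M : 'M_k) 0 (- B) x%:M) U.
  rewrite det_lblock det1 mul1r det_scalar detU => <-.
  rewrite mulmx_block !mul1mx !mul0mx !addr0 mulmx1 !mulNmx.
  rewrite mul_mx_scalar mul_scalar_mx addNr.
  by rewrite det_ublock det_scalar [- _ + _]addrC.
move=> dk.
pose P' := map_mx polyC P; pose Q' := map_mx polyC Q.
have XE : \det ('X%:M - P' *m Q') = 'X ^+ (k - d) * \det ('X%:M - Q' *m P').
  apply: (monic_lreg (monicXn R d)).
  by rewrite mulrA -exprD subnKC // syl.
have hE (n : nat) (A : 'M[R]_n) : (\det ('X%:M - map_mx polyC A)).[t] = \det (t%:M - A).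
  rewrite -horner_evalE -det_map_mx; congr (\det _).
  apply/matrixP => i j; rewrite !mxE /= horner_evalE !hornerE.
  by rewrite hornerMn hornerX.
by have := congr1 (horner^~ t) XE; rewrite -!map_mxM hornerM hornerXn !hE.
Qed.

(** With [a_l] the entries of [Q *m y], Koszul relations turn [C] into a product
    [P *m Q] through the few [a_l]. By Sylvester's identity the determinant is
    then divisible by [t ^+ 2], which is a combination of the [a_l], and the
    other factor kills the [a_l]. *)
Lemma det_few_coefficients (R : comNzRingType) k d (y : 'cV[R]_k)
    (Q : 'M[R]_(d, k)) (C : 'M[R]_k) (c : 'I_d -> 'M[R]_k) (t : R) (q : 'rV[R]_d) :
  (d.+2 <= k)%N ->
  C = \sum_l (Q *m y) l 0 *: c l ->
  (t%:M - C) *m y = 0 ->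
  t ^+ 2 = (q *m (Q *m y)) 0 0 ->
  \det (t%:M - C) = 0.
Proof.
move=> dk CE By tE.
pose P := \matrix_(i, l) dot y (row i (c l)).
have nul i : null_row y (row i (t%:M - C) - row i (t%:M - P *m Q)).
  have -> : row i (t%:M - C) - row i (t%:M - P *m Q) =
      \sum_l (dot y (row i (c l)) *: row l Q - dot y (row l Q) *: row i (c l)).
    rewrite -[LHS]linearB /= opprB addrC addrA subrK linearB /= sumrB.
    congr (_ - _); apply/rowP => j.
      by rewrite !mxE summxE; apply: eq_bigr => l _; rewrite !mxE.
    rewrite CE !mxE !summxE; apply: eq_bigr => l _.
    by rewrite -mulmx_dot !mxE.
  by apply: null_row_sum => l; exact: null_row_koszul.
rewrite (det_null_rows By nul) det_sylvester; last by rewrite ltnW // ltnW.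
have PQy : (t%:M - P *m Q) *m y = 0.
  apply/matrixP => i j; rewrite ord1 mulmx_dot mxE.
  have [+ _] := nul i; rewrite dotB -(mulmx_dot y (t%:M - C)) By mxE sub0r => /eqP.
  by rewrite oppr_eq0 => /eqP.
have Ea : (t%:M - Q *m P) *m (Q *m y) = 0.
  move: PQy; rewrite !mulmxBl !mul_scalar_mx => /(congr1 (mulmx Q)).
  by rewrite mulmxBr mulmx0 -scalemxAr !mulmxA.
set E := \det _; have Eq0 : E * t ^+ 2 = 0.
  have E0 : E *: (Q *m y) = 0 by rewrite -mul_scalar_mx -mul_adj_mx -mulmxA Ea mulmx0.
  rewrite tE; transitivity ((E *: (q *m (Q *m y))) 0 0); first by rewrite [RHS]mxE.
  by rewrite scalemxAr E0 mulmx0 mxE.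
have -> : (k - d = (k - d.+2) + 2)%N by lia.
by rewrite exprD -mulrA [t ^+ 2 * _]mulrC Eq0 mulr0.
Qed.

(** * Relations on generators of the maximal ideal *)

Section SmallEmbeddingDimension.
Variables (R : comNzRingType) (m : idealr R).
Hypothesis noethR : noetherian R.
Hypothesis localR : local_ring m.
Implicit Types (I J K L P : set R).

Let M : set R := [set` m].
Let idM : ideal M := local_ideal localR.

(** Modulo [J] the maximal ideal is principal, so that every nonzero element of
    the quotient is a unit times a power of [y0]. *)
Lemma principal_colon J y0 : ideal J -> J `<=` M -> M y0 ->
  M `<=` ideal_add J (ideal_span [set y0]) ->
  exists c0, J (c0 * y0) /\ forall r, J (r * y0) -> exists s, J (r - s * c0).
Proof.
move=> idJ JM My0 MJ.
have [[e Je]|nJ] := pselect (exists e, J (y0 ^+ e)).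
  have [|e' /asboolP Je' e'min] := @ex_minnP (fun e => `[< J (y0 ^+ e) >]).
    by exists e; apply/asboolP.
  case: e' => [|e'] in Je' e'min.
    by case: (local1 localR); apply: JM.
  exists (y0 ^+ e'); split=> [|r Jr]; first by rewrite -exprSr.
  elim: {-2}e' (leqnn e') => [|i IHi] ie.
    by exists r; rewrite mulr1 subrr; exact: ideal0.
  have [s Js] := IHi (ltnW ie).
  have [Ms|nMs] := pselect (M s).
    have [u Ju [_ /span1P[a ->] uv]] := MJ s Ms.
    exists a; have -> : r - a * y0 ^+ i.+1 = (r - s * y0 ^+ i) + y0 ^+ i * u.
      by rewrite -uv exprSr; ring.
    by apply: (idealD idJ) => //; exact: (idealMl idJ).
  have [v vs] := local_unit noethR localR nMs.
  suff /asboolP/e'min : J (y0 ^+ i.+1) by rewrite ltnS leqNgt ie.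
  have -> : y0 ^+ i.+1 = v * (r * y0 - y0 * (r - s * y0 ^+ i)).
    rewrite exprSr; transitivity ((v * s) * (y0 ^+ i * y0)); last by ring.
    by rewrite vs mul1r.
  by apply: (idealMl idJ); apply: (idealB idJ) => //; exact: (idealMl idJ).
exists 0; split=> [|r Jr]; first by rewrite mul0r; exact: ideal0.
exists 0; rewrite mulr0 subr0.
pose G : set R := [set g | exists i, J (g * y0 ^+ i)].
have idG : ideal G.
  apply/idealP; split=> [|a u v [i Ju] [j Jv]].
    by exists 0%N; rewrite mul0r; exact: ideal0.
  exists (i + j)%N.
  have -> : (a * u + v) * y0 ^+ (i + j) =
     (a * y0 ^+ j) * (u * y0 ^+ i) + y0 ^+ i * (v * y0 ^+ j) by rewrite exprD; ring.
  by apply: (idealD idJ); exact: (idealMl idJ).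
have GM : G `<=` M.
  by apply: local_sub => // -[i]; rewrite mul1r => Ji; apply: nJ; exists i.
apply: (nakayama_local noethR localR idG idJ); last by exists 1%N; rewrite expr1.
move=> g Gg; have [u Ju [_ /span1P[a ->] gE]] := MJ g (GM g Gg).
exists u => //; exists (a * y0) => //; rewrite mulrC.
apply: mem_ideal_mul => //; have [i Ji] := Gg; exists i.+1.
have -> : a * y0 ^+ i.+1 = g * y0 ^+ i - y0 ^+ i * u by rewrite -gE exprS; ring.
by apply: (idealB idJ) => //; exact: (idealMl idJ).
Qed.

Section Relations.
Variables (k : nat) (y : 'cV[R]_k) (i0 i1 : 'I_k) (P : set R).
Hypothesis i01 : i0 != i1.
Hypothesis My : forall x, M x <-> exists c, x = dot y c.
Hypothesis pP : prime_ideal P.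
Hypothesis Py : forall j, j != i0 -> j != i1 -> P (y j 0).
Hypothesis Py1 : ~ P (y i1 0).

Let off (c : 'rV[R]_k) := c 0 i0 = 0 /\ c 0 i1 = 0.
Let p0 : set R := [set r | exists c, off c /\ r = dot y c].

Let idp0 : ideal p0.
Proof.
apply/idealP; split=> [|a _ _ [c [[c0 c1] ->]] [d [[d0 d1] ->]]].
  by exists 0; rewrite /dot mul0mx /off !mxE.
exists (a *: c + d); rewrite dot_lin; split=> //.
by split; rewrite !mxE ?c0 ?d0 ?c1 ?d1 mulr0 addr0.
Qed.

Let dot_off (b : 'rV[R]_k) : exists c, [/\ off c,
  b = b 0 i0 *: delta_mx 0 i0 + b 0 i1 *: delta_mx 0 i1 + c &
  dot y b = b 0 i0 * y i0 0 + b 0 i1 * y i1 0 + dot y c].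
Proof.
pose c := b - (b 0 i0 *: delta_mx 0 i0 + b 0 i1 *: delta_mx 0 i1).
have bE : b = b 0 i0 *: delta_mx 0 i0 + b 0 i1 *: delta_mx 0 i1 + c.
  by rewrite addrC subrK.
exists c; split=> //.
  have i10 : (i1 == i0) = false by rewrite eq_sym (negPf i01).
  by split; rewrite !mxE !eqxx ?(negPf i01) ?i10 /=; ring.
by rewrite [in LHS]bE -addrA !dot_lin !dot_delta addrA.
Qed.

(** The saturation of the ideal [p0] of the other generators by [y_i1]. *)
Let H : set R := [set r | exists i, p0 (y i1 0 ^+ i * r)].

Let idH : ideal H.
Proof.
apply/idealP; split=> [|a u v [i Hu] [j Hv]].
  by exists 0%N; rewrite mulr0; exact: ideal0.
exists (i + j)%N.
have -> : y i1 0 ^+ (i + j) * (a * u + v) =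
   (a * y i1 0 ^+ j) * (y i1 0 ^+ i * u) + y i1 0 ^+ i * (y i1 0 ^+ j * v).
  by rewrite exprD; ring.
by apply: (idealD idp0); exact: (idealMl idp0).
Qed.

Let p0H : p0 `<=` H. Proof. by move=> x px; exists 0%N; rewrite mul1r. Qed.

Let HM : H `<=` M.
Proof.
apply: local_sub => // -[i []]; rewrite mulr1 => c [[c0 c1] yE].
apply: Py1; apply: (primeX pP (k := i)); rewrite yE dotE.
have idP := prime_ideal_ideal pP.
apply: (ideal_sum idP) => j _.
have [->|ji0] := eqVneq j i0; first by rewrite c0 mul0r; exact: ideal0.
have [->|ji1] := eqVneq j i1; first by rewrite c1 mul0r; exact: ideal0.
by apply: (idealMl idP); exact: Py.
Qed.

Let My_ j : M (y j 0).
Proof. by apply/My; exists (delta_mx 0 j); rewrite dot_delta. Qed.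

(** [y_i1] is regular modulo [H] and the maximal ideal is principal modulo [H]
    and [y_i1]. Hence, besides the Koszul relation, one relation generates the
    relations on [y_i0] and [y_i1] modulo [H]. *)
Let relations2 : exists c0 c1, H (c0 * y i0 0 + c1 * y i1 0) /\
  forall b0 b1, H (b0 * y i0 0 + b1 * y i1 0) ->
  exists s t, H (b0 - s * c0 - t * y i1 0) /\ H (b1 - s * c1 + t * y i0 0).
Proof.
pose J := ideal_add H (ideal_span [set y i1 0]).
have idJ : ideal J by apply: ideal_addP => //; exact: ideal_spanP.
have [|||c0 [Jc0 Jr]] := @principal_colon J (y i0 0) idJ.
- by apply: ideal_add_sub => //; apply: span_sub => // _ ->.
- exact: My_.
- move=> _ /My[b ->]; have [c [cO _ ->]] := dot_off b.
  exists (b 0 i1 * y i1 0 + dot y c).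
    exists (dot y c); first by apply: p0H; exists c.
    by exists (b 0 i1 * y i1 0); [apply/span1P; exists (b 0 i1)|rewrite addrC].
  by exists (b 0 i0 * y i0 0); [apply/span1P; exists (b 0 i0)|ring].
have [h Hh [_ /span1P[t ->] hE]] := Jc0.
exists c0, (- t); split; first by rewrite -hE; have -> : h + t * y i1 0 + - t * y i1 0 = h by ring.
move=> b0 b1 Hb.
have /Jr[s [h' Hh' [_ /span1P[t' ->] h'E]]] : J (b0 * y i0 0).
  exists (b0 * y i0 0 + b1 * y i1 0) => //; exists (- b1 * y i1 0); last by ring.
  by apply/span1P; exists (- b1).
exists s, t'; split; first by rewrite -h'E addrK.
have [i Hi] : H (y i1 0 * (b1 - s * - t + t' * y i0 0)).
  have -> : y i1 0 * (b1 - s * - t + t' * y i0 0) =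
     (b0 * y i0 0 + b1 * y i1 0) - s * h - h' * y i0 0.
    have -> : b0 = h' + t' * y i1 0 + s * c0 by rewrite h'E subrK.
    have -> : h = c0 * y i0 0 - t * y i1 0 by rewrite -hE addrK.
    by ring.
  by apply: (idealB idH); [apply: (idealB idH) => //; exact: (idealMl idH)|exact: (idealMr idH)].
by exists i.+1; rewrite exprSr -mulrA.
Qed.

(** [H] needs only one generator besides the [y_j] in [p0], namely the value on
    [y] of a vector [g] that is a relation modulo [H]. Any relation is therefore
    congruent, modulo Koszul relations, to a combination of [g] and the unit
    vectors [e_j] for [j] different from [i0] and [i1]: these are too few rows
    to support a nonzero determinant. *)
Lemma det_relations_eq0 (B : 'M[R]_k) : B *m y = 0 -> \det B = 0.
Proof.
move=> By; have [c0 [c1 [Hc rel]]] := relations2.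
pose e0 : 'rV[R]_k := delta_mx 0 i0; pose e1 : 'rV[R]_k := delta_mx 0 i1.
pose g := c0 *: e0 + c1 *: e1.
have dotg : dot y g = c0 * y i0 0 + c1 * y i1 0.
  by rewrite dot_lin dotZ !dot_delta.
have HE : H `<=` ideal_add p0 (ideal_span [set dot y g]).
  apply: (nakayama_local noethR localR) => //.
    by apply: ideal_addP => //; exact: ideal_spanP.
  move=> h Hh; have /My[b hE] := HM Hh; have [c [cO _ dotb]] := dot_off b.
  have [|s [t [Hu Hv]]] := rel (b 0 i0) (b 0 i1).
    have -> : b 0 i0 * y i0 0 + b 0 i1 * y i1 0 = h - dot y c.
      by rewrite hE dotb addrK.
    by apply: (idealB idH) => //; apply: p0H; exists c.
  exists (dot y c + s * dot y g).
    exists (dot y c); first by exists c.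
    by exists (s * dot y g) => //; apply/span1P; exists s.
  exists ((b 0 i0 - s * c0 - t * y i1 0) * y i0 0 + (b 0 i1 - s * c1 + t * y i0 0) * y i1 0).
    by apply: (idealD (ideal_mulP _ _)); rewrite mulrC;
       apply: mem_ideal_mul => //; exact: My_.
  by rewrite hE dotb dotg; ring.
pose Q : 'M[R]_k := \matrix_(i, j)
  (if i == i0 then g 0 j else if i == i1 then 0 else (i == j)%:R).
have Q0 : \det Q = 0.
  rewrite (expand_det_row Q i1) big1 // => j _.
  by rewrite mxE eq_sym (negPf i01) eqxx mul0r.
apply: (det_null_span By Q0) => i; set b := row i B.
have dotb0 : dot y b = 0 by rewrite /b -mulmx_dot By mxE.
have [c [cO bE dotb]] := dot_off b.
have [|s [t [/HE[_ [u [uO ->]] [_ /span1P[z ->] uE]]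
             /HE[_ [v [vO ->]] [_ /span1P[z' ->] vE]]]]] := rel (b 0 i0) (b 0 i1).
  have -> : b 0 i0 * y i0 0 + b 0 i1 * y i1 0 = - dot y c.
    by apply/eqP; rewrite -addr_eq0 -dotb dotb0.
  by apply: (idealN idH); apply: p0H; exists c.
pose w := (s + z * y i0 0 + z' * y i1 0) *: g + (c + y i0 0 *: u + y i1 0 *: v).
have [p pE] : exists p, p *m Q = w.
  pose a := s + z * y i0 0 + z' * y i1 0.
  pose f := c + y i0 0 *: u + y i1 0 *: v.
  have [f0 f1] : off f.
    by case: cO uO vO => [c_0 c_1] [u_0 u_1] [v_0 v_1]; split;
      rewrite !mxE ?c_0 ?u_0 ?v_0 ?c_1 ?u_1 ?v_1; ring.
  exists (a *: e0 + f); rewrite mulmxDl -scalemxAl; congr (_ *: _ + _).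
    by rewrite -rowE; apply/rowP => j; rewrite !mxE eqxx.
  rewrite -[RHS]mulmx1; apply/rowP => j; rewrite !mxE; apply: eq_bigr => l _.
  have [->|li0] := eqVneq l i0; first by rewrite f0 !mul0r.
  have [->|li1] := eqVneq l i1; first by rewrite f1 !mul0r.
  by rewrite !mxE (negPf li0) (negPf li1).
exists p; rewrite pE.
have -> : b - w = t *: (dot y e1 *: e0 - dot y e0 *: e1)
    + ((dot y u *: e0 - dot y e0 *: u) + (dot y v *: e1 - dot y e1 *: v)
    + (z *: (dot y g *: e0 - dot y e0 *: g) + z' *: (dot y g *: e1 - dot y e1 *: g))).
  rewrite bE /w !dot_delta.
  have -> : b 0 i0 = s * c0 + t * y i1 0 + (dot y u + z * dot y g) by rewrite uE; ring.
  have -> : b 0 i1 = s * c1 - t * y i0 0 + (dot y v + z' * dot y g) by rewrite vE; ring.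
  by apply/rowP => j; rewrite !mxE; ring.
apply: null_rowD; first by apply: null_rowZ; exact: null_row_koszul.
apply: null_rowD; first by apply: null_rowD; exact: null_row_koszul.
by apply: null_rowD; apply: null_rowZ; exact: null_row_koszul.
Qed.

End Relations.
End SmallEmbeddingDimension.

(** By Krull's height theorem the maximal ideal is not minimal over [k - 2] of
    its generators, so that one of the two others is not nilpotent modulo
    these. *)
Lemma det_relations_local (R : comNzRingType) (m : idealr R) d k (y : 'cV[R]_k)
    (B : 'M[R]_k) :
  noetherian R -> local_ring m -> krull_dim R d -> (0 < d)%N -> (k <= d.+1)%N ->
  (forall x, x \in m <-> exists c, x = dot y c) ->
  B *m y = 0 -> \det B = 0.
Proof.
move=> noethR localR dimR d_gt0.
have ge2 k' (y' : 'cV[R]_k'.+2) (B' : 'M[R]_k'.+2) : (k'.+2 <= d.+1)%N ->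
    (forall x, x \in m <-> exists c, x = dot y' c) -> B' *m y' = 0 -> \det B' = 0.
  rewrite ltnS => k'd my' By'.
  pose i0 : 'I_k'.+2 := ord0; pose i1 : 'I_k'.+2 := lift ord0 ord0.
  have [||P [pP PM MP Pb]] := local_dim_avoid noethR localR dimR
      (b := [seq y' (lift ord0 (lift ord0 j)) 0 | j <- enum 'I_k']).
  - by rewrite size_map size_enum_ord.
  - move=> _ /mapP[j _ ->] /=; apply/my'; exists (delta_mx 0 (lift ord0 (lift ord0 j))).
    by rewrite dot_delta.
  have Py j : j != i0 -> j != i1 -> P (y' j 0).
    case: (unliftP ord0 j) => [j1 ->|-> //] _.
    case: (unliftP ord0 j1) => [j2 ->|-> //] _.
    by apply: Pb; apply: map_f; rewrite mem_enum.
  have [Py0|nPy0] := pselect (P (y' i0 0)).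
    apply: (det_relations_eq0 noethR localR (i0 := i0) (i1 := i1) _ my' pP) => //.
    move=> Py1; apply: MP => x /my'[c ->]; rewrite dotE.
    have idP := prime_ideal_ideal pP; apply: (ideal_sum idP) => j _.
    apply: (idealMl idP); have [->//|ji0] := eqVneq j i0.
    by have [->//|ji1] := eqVneq j i1; exact: Py.
  apply: (det_relations_eq0 noethR localR (i0 := i1) (i1 := i0) _ my' pP) => //.
  by move=> j ji1 ji0; exact: Py.
case: k => [|[|k]] in y B * => kd my By.
- have [//|//|P [pP _ []]] := local_dim_avoid noethR localR dimR (b := [::]).
  move=> x /my[c ->]; rewrite dotE big_ord0.
  exact: (ideal0 (prime_ideal_ideal pP)).
- (* Two indices are needed: a single generator is padded by the generator 0. *)
  pose B2 : 'M[R]_(1 + 1) := block_mx 1%:M 0 0 B.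
  pose y2 : 'cV[R]_(1 + 1) := col_mx 0 y.
  have <- : \det B2 = \det B by rewrite det_ublock det1 mul1r.
  apply: (ge2 0%N y2 B2) => // [x|].
    split=> [/my[c ->]|[c ->]].
      exists (row_mx 0 c : 'rV_(1 + 1)).
      rewrite -[dot y2 _]/((row_mx (0 : 'rV_1) c *m col_mx (0 : 'cV_1) y) 0 0).
      by rewrite mul_row_col mul0mx add0r.
    apply/my; pose c2 : 'rV[R]_(1 + 1) := c; exists (rsubmx c2).
    rewrite -[dot y2 c]/((c2 *m y2) 0 0) -[c2 in LHS]hsubmxK.
    by rewrite /y2 mul_row_col mulmx0 add0r.
  rewrite -[B2 *m y2]/((B2 : 'M_(1 + 1)) *m (y2 : 'cV_(1 + 1))).
  by rewrite [LHS](@mul_block_col _ 1 1 1 1 1) !mul0mx !mulmx0 By !addr0 col_mx0.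
- exact: ge2 my By.
Qed.

(** * Forms with a unit coefficient *)

Section ResidueField.
Variables (R : comNzRingType) (m : idealr R).
Hypothesis noethR : noetherian R.
Hypothesis localR : local_ring m.
Hypothesis inf_residue : infinite_set [set: {ideal_quot m}].

Let M : set R := [set` m].
Let idM : ideal M := local_ideal localR.
Let pM : prime_ideal M := local_prime noethR localR.

Lemma distinct_residues : exists s : nat -> R,
  forall i j, i != j -> ~ M (s i - s j).
Proof.
have /infiniteP/card_leP[f] := inf_residue.
exists (fun i => repr (val (f (to_setT i)))) => i j /eqP ij Mij; apply: ij.
have ff : f (to_setT i) = f (to_setT j).
  apply/val_inj; rewrite -[LHS]reprK -[RHS]reprK; apply/eqP.
  by rewrite -Quotient.idealrBE.
by have /(congr1 val) := @inj _ _ setT f _ _ (in_setT _) (in_setT _) ff.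
Qed.

(** A nonzero polynomial over the residue field has fewer roots than its size;
    the linear factors are split off over the ring itself. *)
Lemma coef_local (s : nat -> R) k (p : {poly R}) :
  (forall i j, i != j -> ~ M (s i - s j)) -> (size p <= k)%N ->
  (forall i, (i < k)%N -> M p.[s i]) -> forall e, M p`_e.
Proof.
move=> sM; elim: k => [|k IHk] in p *.
  rewrite leqn0 size_poly_eq0 => /eqP -> _ e; rewrite coef0; exact: ideal0.
move=> pk pM' e.
have /factor_theorem[q qE] : root (p - (p.[s k])%:P) (s k).
  by rewrite rootE !hornerE subrr.
have {qE}pE : p = q * ('X - (s k)%:P) + (p.[s k])%:P by rewrite -qE subrK.
have qk : (size q <= k)%N.
  have [->|q0] := eqVneq q 0; first by rewrite size_poly0.
  have : (size (q * ('X - (s k)%:P))%R <= k.+1)%N.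
    have -> : q * ('X - (s k)%:P) = p - (p.[s k])%:P.
      by apply/esym/eqP; rewrite subr_eq; apply/eqP.
    rewrite (leq_trans (size_polyD _ _)) // geq_max pk size_polyN.
    by rewrite (leq_trans (size_polyC_leq1 _)).
  by rewrite size_Mmonic ?monicXsubC // size_XsubC addn2 /= ltnS.
have qM i : M q`_i.
  apply: IHk => // j jk; have := pM' j (ltnW jk).
  have kj : ~ M (s j - s k) by apply: sM; rewrite neq_ltn jk.
  move=> Mpj; have : M (q.[s j] * (s j - s k)).
    have -> : q.[s j] * (s j - s k) = p.[s j] - p.[s k].
      by have := congr1 (horner^~ (s j)) pE; rewrite !hornerE => ->; ring.
    by apply: (idealB idM) => //; exact: pM'.
  by rewrite mulrC => Mq; exact: (primeMr pM Mq).
rewrite pE coefD; apply: (idealD idM).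
  rewrite mulrBr coefB coefMX coefMC; apply: (idealB idM); last exact: (idealMr idM).
  by case: eqP => // _; exact: ideal0.
rewrite coefC; case: eqP => _; [exact: pM'|exact: ideal0].
Qed.

Lemma unit_value (p : {poly R}) e : ~ M p`_e -> exists s, ~ M p.[s].
Proof.
move=> pe; apply: contrapT => /forallNP pM'; apply: pe.
have [s sM] := distinct_residues.
by apply: (coef_local sM (leqnn _)) => i _; apply: contrapT; exact: pM'.
Qed.

End ResidueField.

Lemma digits_inj d b (c c' : 'I_d -> nat) :
  (forall i, (c i < b)%N) -> (forall i, (c' i < b)%N) ->
  \sum_i (c i * b ^ i)%N = \sum_i (c' i * b ^ i)%N -> c =1 c'.
Proof.
elim: d => [|d IHd] in c c' * => cb cb' E i; first by case: i.
have split_ f : \sum_(i < d.+1) (f i * b ^ i)%N =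
    ((\sum_(i < d) f (lift ord0 i) * b ^ i) * b + f ord0)%N.
  rewrite big_ord_recl muln1 addnC big_distrl /=; congr (_ + _)%N.
  by apply: eq_bigr => j _; rewrite -mulnA -expnSr.
move: E; rewrite !split_ => E.
have b_gt0 : (0 < b)%N by apply: leq_ltn_trans (cb ord0).
have [/= Eq Er] : \sum_(i < d) (c (lift ord0 i) * b ^ i)%N =
    \sum_(i < d) (c' (lift ord0 i) * b ^ i)%N /\ c ord0 = c' ord0.
  have := congr1 (divn^~ b) E; have := congr1 (modn^~ b) E.
  by rewrite !modnMDl !divnMDl // !modn_small // !divn_small // !addn0.
case: (unliftP ord0 i) => [j ->|->] //.
exact: (IHd _ _ (fun j => cb _) (fun j => cb' _) Eq).
Qed.

Section UnitForm.
Variables (R : comNzRingType) (m : idealr R).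
Hypothesis noethR : noetherian R.
Hypothesis localR : local_ring m.
Hypothesis inf_residue : infinite_set [set: {ideal_quot m}].
Variables (d n : nat) (a : 'I_d -> R) (x : R).
Hypothesis n_gt0 : (0 < n)%N.

Let M : set R := [set` m].
Let Q := ideal_span (range a).
Let I := ideal_add Q (ideal_span [set x]).
Let K := ideal_mul Q (ideal_exp I n.-1).

Let idQ : ideal Q := ideal_spanP _.
Let idI : ideal I := ideal_addP idQ (ideal_spanP _).
Let idK : ideal K := ideal_mulP _ _.

Let z (o : option 'I_d) := if o is Some l then a l else x.
Let mono (l : seq (option 'I_d)) := \prod_(o <- l) z o.

Let power_mono k : ideal_exp I k `<=`
  ideal_span [set mono l | l in [set l | size l = k]].
Proof.
elim: k => [|k IHk].
  have -> : [set mono l | l in [set l | size l = 0%N]] = [set 1].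
    apply/seteqP; split=> [_ [l /= /size0nil -> <-]|_ ->].
      by rewrite /mono big_nil.
    by exists [::]; rewrite /mono ?big_nil.
  by move=> y _; apply/span1P; exists y; rewrite mulr1.
set G := [set _ | _ in _].
suff zG o y : ideal_exp I k y -> ideal_span G (z o * y).
  apply: ideal_mul_sub => [|_ y [u Qu [_ /span1P[b ->] <-]] Iy].
    exact: ideal_spanP.
  rewrite mulrDl; apply: (idealD (ideal_spanP _)); last first.
    by rewrite -mulrA; apply: (idealMl (ideal_spanP _)); exact: (zG None).
  apply: (@span_sub _ (range a) [set u | ideal_span G (u * y)]) Qu => [|_ [l _ <-]].
    apply/idealP; split=> [|r v w /= Gv Gw].
      by rewrite /= mul0r; exact: (ideal0 (ideal_spanP _)).
    rewrite mulrDl -mulrA; apply: (idealD (ideal_spanP _)) => //.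
    exact: (idealMl (ideal_spanP _)).
  exact: (zG (Some l)).
move=> /IHk; apply: (@span_sub _ _ [set y | ideal_span G (z o * y)]).
  apply/idealP; split=> [|r v w /= Gv Gw].
    by rewrite /= mulr0; exact: (ideal0 (ideal_spanP _)).
  rewrite mulrDr mulrCA; apply: (idealD (ideal_spanP _)) => //.
  exact: (idealMl (ideal_spanP _)).
move=> _ [l lk <-] /=; apply: sub_span; exists (o :: l); first by rewrite /= lk.
by rewrite /mono big_cons.
Qed.

Let monoK (l : seq (option 'I_d)) : Prop := size l = n /\ K (mono l).

Let Kmono : K `<=` ideal_span [set mono l | l in monoK].
Proof.
set G := [set _ | _ in _].
apply: ideal_mul_sub => [|u y Qu Iy]; first exact: ideal_spanP.
apply: (@span_sub _ (range a) [set u | ideal_span G (u * y)]) Qu => [|_ [l _ <-]].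
  apply/idealP; split=> [|r v w /= Gv Gw].
    by rewrite /= mul0r; exact: (ideal0 (ideal_spanP _)).
  rewrite mulrDl -mulrA; apply: (idealD (ideal_spanP _)) => //.
  exact: (idealMl (ideal_spanP _)).
move: Iy => /power_mono.
apply: (@span_sub _ _ [set y | ideal_span G (a l * y)]).
  apply/idealP; split=> [|r v w /= Gv Gw].
    by rewrite /= mulr0; exact: (ideal0 (ideal_spanP _)).
  rewrite mulrDr mulrCA; apply: (idealD (ideal_spanP _)) => //.
  exact: (idealMl (ideal_spanP _)).
move=> _ [l' l'n <-] /=; apply: sub_span; exists (Some l :: l'); last first.
  by rewrite /mono big_cons.
split; first by rewrite /= l'n prednK.
rewrite /mono big_cons; apply: mem_ideal_mul; first by apply: sub_span; exists l.
rewrite -l'n (big_nth None) big_mkord; apply: ideal_exp_prod => i.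
case: (nth _ _ _) => [j|] /=.
  by apply: ideal_addl; [exact: ideal_spanP|apply: sub_span; exists j].
by apply: ideal_addr => //; exact: sub_span.
Qed.

Let wt (o : option 'I_d) : nat := if o is Some l then n.+1 ^ l else 0.
Let Wt l := (\sum_(o <- l) wt o)%N.

Let WtE l : Wt l = (\sum_(j < d) count_mem (Some j) l * n.+1 ^ j)%N.
Proof.
rewrite /Wt; elim: l => [|o l IHl]; first by rewrite big_nil big1.
rewrite big_cons IHl; case: o => [i|] /=.
  under [in RHS]eq_bigr do rewrite mulnDl.
  rewrite big_split /=; congr (_ + _)%N.
  rewrite (bigD1 i) //= eqxx mul1n big1 ?addn0 // => j ji.
  by rewrite (_ : (_ == _) = false) ?mul0n //; apply/eqP => -[] /eqP; rewrite eq_sym (negPf ji).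
by apply: eq_bigr.
Qed.

Let count_some (l : seq (option 'I_d)) :
  (count_mem None l + \sum_(j < d) count_mem (Some j) l)%N = size l.
Proof.
elim: l => [|o l IHl]; first by rewrite big1.
rewrite /= big_split /= addnACA IHl -add1n; congr (_ + _)%N.
case: o => [i|] /=; last by rewrite big1.
rewrite add0n (bigD1 i) //= eqxx big1 // => j ji.
by rewrite (_ : (_ == _) = false) //; apply/eqP => -[] /eqP; rewrite eq_sym (negPf ji).
Qed.

(** Monomials of degree [n] are determined by their weight, whose digits in base
    [n + 1] are the exponents of the [a_l]. *)
Let mono_wt l l' : size l = n -> size l' = n -> Wt l = Wt l' -> mono l = mono l'.
Proof.
move=> ln l'n; rewrite !WtE => W.
have cnt j : count_mem (Some j) l = count_mem (Some j) l'.
  move: j; apply: (digits_inj _ _ W) => i; rewrite ltnS.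
    by rewrite -ln count_size.
  by rewrite -l'n count_size.
apply: perm_big; apply/allP => -[j|] _ /=; first by rewrite cnt.
apply/eqP/(@addIn (\sum_(j < d) count_mem (Some j) l)).
by rewrite count_some (eq_bigr _ (fun j _ => cnt j)) count_some ln.
Qed.

(** Writing [w x^n] as a form of degree [n] in [x] and the [a_l], one coefficient
    is a unit. Replacing [a_l] by [a_l - t_l x] makes the form monic in [x] as
    soon as its value at [(1, t)] is a unit. Taking for [t_l] the powers of one
    element [s] with exponents the powers of [n + 1] turns this value into that
    of a polynomial in [s] with the same coefficients. *)
Lemma unit_form w : M w -> K (w * x ^+ n) -> ~ ideal_mul M K (w * x ^+ n) ->
  exists t : 'I_d -> R,
    ideal_mul (ideal_span (range (fun l => a l - t l * x))) (ideal_exp I n.-1) (x ^+ n).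
Proof.
move=> Mw Kw nMKw; have idM := local_ideal localR.
have [s [sG wE]] := (spanP _ _).1 (Kmono Kw).
have : forall g, exists l, [set mono l | l in monoK] g -> monoK l /\ mono l = g.
  move=> g; have [[l lK lg]|no] := pselect ([set mono l | l in monoK] g).
    by exists l.
  by exists [::].
move=> /choice[f fP].
have {sG} sP c : c \in s -> monoK (f c.2) /\ mono (f c.2) = c.2.
  by move=> /sG/fP.
pose p : {poly R} := \sum_(c <- s) c.1 *: 'X^(Wt (f c.2)).
have [e pe] : exists e, ~ M p`_e.
  apply: contrapT => /forallNP pM; apply: nMKw.
  pose D := \max_(c <- s) Wt (f c.2).
  have WD c : c \in s -> (Wt (f c.2) < D.+1)%N.
    by move=> cs; rewrite ltnS; exact: (leq_bigmax_seq (F := fun c => Wt (f c.2))).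
  rewrite wE big_seq (partition_big (fun c => inord (Wt (f c.2)) : 'I_D.+1) xpredT) //=.
  apply: (ideal_sum (ideal_mulP _ _)) => e _.
  have [/hasP[c0 c0s /eqP c0e]|/hasPn none] := boolP (has (fun c => Wt (f c.2) == e) s); last first.
    rewrite big1; first exact: (ideal0 (ideal_mulP _ _)).
    move=> c /andP[cs /eqP ce].
    by have := none c cs; rewrite -ce inordK ?eqxx // WD.
  have -> : \sum_(c <- s | (c \in s) && (inord (Wt (f c.2)) == e)) c.1 * c.2
          = p`_e * mono (f c0.2).
    rewrite coef_sum mulr_suml [RHS]big_seq big_mkcondr /=.
    apply: eq_bigr => c cs; rewrite coefZ coefXn -val_eqE /= inordK ?WD // [in RHS]eq_sym.
    case: eqP => [ce|]; last by rewrite mulr0 mul0r.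
    rewrite mulr1; have [[cn _] <-] := sP c cs; congr (_ * _).
    by apply: mono_wt => //; [have [[]] := sP c0 c0s|rewrite ce].
  apply: mem_ideal_mul; first by apply: contrapT; exact: pM.
  by have [[_]] := sP c0 c0s.
have [b pb] := unit_value noethR localR inf_residue pe.
pose t l := b ^+ wt (Some l); exists t.
set Q' := ideal_span _; have idQ' : ideal Q' by exact: ideal_spanP.
have Qz o : Q' (z o - b ^+ wt o * x).
  case: o => [l|] /=; first by apply: sub_span; exists l.
  by rewrite expr0 mul1r subrr; exact: ideal0.
have Iz o : I (z o).
  case: o => [j|] /=.
    by apply: ideal_addl; [exact: ideal_spanP|apply: sub_span; exists j].
  by apply: ideal_addr => //; exact: sub_span.
have Q'I : Q' `<=` I.
  apply: span_sub => // _ [l _ <-]; apply: (idealB idI); first exact: (Iz (Some l)).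
  by apply: (idealMl idI); exact: (Iz None).
set K' := ideal_mul _ _.
have monoE l : size l = n -> K' (mono l - b ^+ Wt l * x ^+ n).
  move=> ln.
  have -> : b ^+ Wt l * x ^+ n = \prod_(i < size l) (b ^+ wt (nth None l i) * x).
    rewrite big_split /=; congr (_ * _); last by rewrite prodr_const card_ord ln.
    by rewrite prodrXr /Wt (big_nth None) big_mkord.
  rewrite /mono (big_nth None) big_mkord /K' -ln.
  apply: (prod_congr idI Q'I) => i //.
  by apply: (idealMl idI); exact: (Iz None).
have : K' ((w - p.[b]) * x ^+ n).
  have -> : (w - p.[b]) * x ^+ n = \sum_(c <- s) c.1 * (c.2 - b ^+ Wt (f c.2) * x ^+ n).
    rewrite mulrBl wE horner_sum mulr_suml -sumrB; apply: eq_bigr => c _.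
    by rewrite !hornerE; ring.
  rewrite big_seq; apply: (ideal_sum (ideal_mulP _ _)) => c cs.
  apply: (idealMl (ideal_mulP _ _)); have [[cn _] cE] := sP c cs.
  by rewrite -{1}cE; exact: monoE.
have [|v vE] := local_unit noethR localR (u := w - p.[b]).
  by move=> Mwp; apply: pb; rewrite -(subKr w p.[b]); exact: (idealB idM).
by move=> /(idealMl (ideal_mulP _ _) v); rewrite mulrA vE mul1r.
Qed.

End UnitForm.

(** * Reductions *)

Lemma least_le (A : set nat) k : A k -> (least A <= k)%N.
Proof.
by move=> Ak; rewrite /least; case: xgetP => [n _ [_ nmin]|//]; exact: nmin.
Qed.

Lemma least_mem (A : set nat) : A !=set0 -> A (least A).
Proof.
move=> [k Ak]; rewrite /least.
have [|n /asboolP An nmin] := @ex_minnP (fun n => `[< A n >]).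
  by exists k; apply/asboolP.
have /(xgetPex 0%N)[] // : exists n, A n /\ forall k, A k -> (n <= k)%N.
by exists n; split=> // j Aj; apply: nmin; apply/asboolP.
Qed.

Section Reductions.
Variable R : comNzRingType.
Implicit Types (I J K L Q : set R).

Lemma nu_generators I : noetherian R -> ideal I ->
  exists s : seq R, size s = nu I /\ I = ideal_span [set` s].
Proof.
move=> noethR idI; have [s sE] := noethR _ idI.
have [|t tE tsz] := @least_mem [set size s | s in [set s : seq R | I = ideal_span [set` s]]].
  by exists (size s), s.
by exists t.
Qed.

Lemma length1_between J K L : quotient_length J K 1 ->
  ideal L -> K `<=` L -> L `<=` J -> L `<=` K \/ J `<=` L.
Proof.
move=> [idJ idK KJ [_ noch]] idL KL LJ; apply: contrapT => /not_orP[LK JL].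
suff : (2 <= 1)%N by [].
apply: noch; exists (fun i : 'I_3 => nth J [:: K; L] i); split.
  by case=> -[|[|[|]]] //= _; split=> // x /KL/LJ.
have KL' : K `<` L by split.
have LJ' : L `<` J by split.
have KJ' : K `<` J by split=> // JK; apply: LK => x /LJ/JK.
by case=> -[|[|[|]]] // i3 [[|[|[|]]] // j3].
Qed.

Lemma length1_proper J K : quotient_length J K 1 -> ~ J `<=` K.
Proof.
move=> [_ _ _ [[X [XP X_mono]] _]] JK.
have [_ +] := X_mono ord0 ord_max isT; apply.
by have [_ KX _] := XP ord0; have [_ _ XJ] := XP ord_max; move=> x /XJ/JK/KX.
Qed.

Lemma power_decomp Q (x : R) k : ideal Q ->
  let I := ideal_add Q (ideal_span [set x]) in
  ideal_exp I k.+1 `<=`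
    ideal_add (ideal_mul Q (ideal_exp I k)) (ideal_span [set x ^+ k.+1]).
Proof.
move=> idQ I; have idI : ideal I by apply: ideal_addP => //; exact: ideal_spanP.
have idS j : ideal (ideal_add (ideal_mul Q (ideal_exp I j)) (ideal_span [set x ^+ j.+1])).
  by apply: ideal_addP; [exact: ideal_mulP|exact: ideal_spanP].
have Ix : I x by apply: ideal_addr => //; exact: sub_span.
have QI : Q `<=` I by apply: ideal_addl; exact: ideal_spanP.
elim: k => [|k IHk].
  by rewrite ideal_exp1 // ideal_exp0 ideal_mulC ideal_mulTl.
rewrite ideal_expS; apply: ideal_mul_sub => // _ w [u Qu [_ /span1P[b ->] <-]] Iw.
rewrite mulrDl; apply: (idealD (idS k.+1)).
  by apply: ideal_addl; [exact: ideal_spanP|exact: mem_ideal_mul].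
have [v Kv [_ /span1P[c ->] <-]] := IHk w Iw.
rewrite mulrDr; apply: (idealD (idS k.+1)); last first.
  apply: ideal_addr; first exact: ideal_mulP.
  by apply/span1P; exists (b * c); rewrite [x ^+ k.+2]exprS; ring.
apply: ideal_addl; first exact: ideal_spanP.
rewrite -mulrA; apply: (idealMl (ideal_mulP _ _)).
rewrite [ideal_exp I k.+1]ideal_expS ideal_mulA (ideal_mulC Q) -ideal_mulA.
exact: mem_ideal_mul.
Qed.

Lemma reduction_of_power Q (x : R) k : ideal Q ->
  let I := ideal_add Q (ideal_span [set x]) in
  ideal_mul Q (ideal_exp I k) (x ^+ k.+1) ->
  ideal_exp I k.+1 = ideal_mul Q (ideal_exp I k).
Proof.
move=> idQ I Qx; apply/seteqP; split.
  apply: subset_trans (power_decomp idQ) _; apply: ideal_add_sub => //.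
    exact: ideal_mulP.
  by apply: span_sub => [|_ -> //]; exact: ideal_mulP.
by apply: ideal_mulS => //; apply: ideal_addl; exact: ideal_spanP.
Qed.

Lemma reduction_number_le d I Q k : minimal_reduction d I Q ->
  ideal_exp I k.+1 = ideal_mul Q (ideal_exp I k) -> (reduction_number d I <= k)%N.
Proof.
move=> redQ Qk; apply: (@leq_trans (reduction_number_wrt Q I)).
  by apply: least_le; exists Q.
exact: least_le.
Qed.

Lemma minimal_reduction_range d (a : 'I_d -> R) I k :
  let Q := ideal_span (range a) in
  Q `<=` I -> ideal_exp I k.+1 = ideal_mul Q (ideal_exp I k) ->
  minimal_reduction d I Q.
Proof.
move=> Q QI Qk; split=> //; last by exists k.
exists [tuple a l | l < d]; congr ideal_span; apply/seteqP; split=> x /=.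
  by move=> [l _ <-]; apply/tnthP; exists l; rewrite tnth_mktuple.
by move=> /tnthP[l ->]; exists l => //; rewrite tnth_mktuple.
Qed.

End Reductions.

Section MinimalReductions.
Variables (R : comNzRingType) (m : idealr R) (d : nat).
Hypothesis noethR : noetherian R.
Hypothesis localR : local_ring m.
Hypothesis dimR : krull_dim R d.

Let M : set R := [set` m].
Let idM : ideal M := local_ideal localR.

Variables (I : set R) (a : 'I_d -> R) (r : nat).
Let Q := ideal_span (range a).
Hypothesis idI : ideal I.
Hypothesis IM : I `<=` M.
Hypothesis MI : forall x, M x -> exists e, I (x ^+ e).
Hypothesis QI : Q `<=` I.
Hypothesis redQ : ideal_exp I r.+1 = ideal_mul Q (ideal_exp I r).

(** Otherwise the [b] would generate a reduction of [I], and a power of the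
    maximal ideal would lie in an ideal with fewer than [d] generators. *)
Lemma reduction_needs_generators (b : seq R) : (size b < d)%N ->
  (forall x, x \in b -> M x) ->
  ~ Q `<=` ideal_add (ideal_span [set` b]) (ideal_mul M I).
Proof.
move=> bd bM Qb.
have [P [pP _ MP Pb]] := local_dim_avoid noethR localR dimR bd bM.
have idb : ideal (ideal_span [set` b]) by exact: ideal_spanP.
have Jb : ideal_exp I r.+1 `<=` ideal_span [set` b].
  apply: (nakayama_local noethR localR) => //; first exact: ideal_expP.
  rewrite {1}redQ; apply: subset_trans (ideal_mulS Qb (@subset_refl _ _)) _.
  apply: subset_trans (@ideal_mulDl_sub _ _ _ _) _.
  apply: ideal_add_sub.
  - by apply: ideal_addP => //; exact: ideal_mulP.
  - apply: subset_trans (ideal_mul_subl idb) _.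
    by apply: ideal_addl; exact: ideal_mulP.
  by rewrite -ideal_mulA -ideal_expS; exact: ideal_addr.
apply: MP => x /MI[e Ie]; apply: (primeX pP (k := e)).
apply: (primeX pP (k := r.+1)); have := Jb _ (mem_ideal_exp r.+1 Ie).
by apply: span_sub => //; exact: prime_ideal_ideal.
Qed.

(** Either the element can be ignored by Nakayama's lemma, or it can be exchanged
    against one of the generators. *)
Lemma span_unit_coef (s : seq R) v : ideal_span [set` s] v ->
  ideal_mul M (ideal_span [set` s]) v \/
  exists s1 g s2, s = s1 ++ g :: s2 /\
    exists c, ~ M c /\ ideal_span [set` s1 ++ s2] (v - c * g).
Proof.
elim: s v => [|g s IHs] v.
  move=> /span_seqP[c ->]; left; rewrite big_ord0; exact: (ideal0 (ideal_mulP _ _)).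
have sub_cons t u : ideal_span [set` t] `<=` ideal_span [set` u :: t].
  apply: span_sub; first exact: ideal_spanP.
  by move=> w wt; apply: sub_span => /=; rewrite inE; apply/orP; right.
move=> /span_seqP[c ->]; rewrite big_ord_recl /=.
set w := \sum_(_ < _) _; have sw : ideal_span [set` s] w.
  by apply/span_seqP; exists (fun i => c (lift ord0 i)).
move: (c ord0) w sw => {}c w sw.
have [Mc|nMc] := pselect (M c); last first.
  right; exists [::], g, s; split=> //; exists c; split=> //=.
  by rewrite addrAC subrr add0r.
have [Mw|[s1 [h [s2 [-> [b [nMb sb]]]]]]] := IHs w sw.
  left; apply: (idealD (ideal_mulP _ _)).
    by apply: mem_ideal_mul => //; apply: sub_span; exact: mem_head.
  by move: Mw; apply: ideal_mulS => //; exact: sub_cons.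
right; exists (g :: s1), h, s2; split=> //; exists b; split=> //.
rewrite -addrA; apply: (idealD (ideal_spanP _)).
  by apply: (idealMl (ideal_spanP _)); apply: sub_span; exact: mem_head.
exact: sub_cons.
Qed.

(** The [a_l] are exchanged one by one against generators of [I]. *)
Lemma reduction_complement (s : seq R) : size s = d.+1 ->
  I = ideal_span [set` s] -> exists x, I = ideal_add Q (ideal_span [set x]).
Proof.
move=> sz sE.
pose A j := ideal_span [set a l | l in [set l : 'I_d | (l < j)%N]].
have idA j : ideal (A j) by exact: ideal_spanP.
have step j : (j <= d)%N -> exists t : seq R,
    size t = (d.+1 - j)%N /\ I = ideal_add (A j) (ideal_span [set` t]).
  elim: j => [_|j IHj jd].
    exists s; split; first by rewrite subn0.
    have A0 : A 0%N `<=` I by apply: span_sub => // x [l].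
    apply/seteqP; split; last by apply: ideal_add_sub => //; rewrite sE.
    by rewrite {1}sE; exact: ideal_addr.
  have [t [tsz tE]] := IHj (ltnW jd); pose l0 := Ordinal jd.
  have Il l : I (a l) by apply: QI; apply: sub_span; exists l.
  have : I (a l0) by [].
  rewrite {1}tE => -[u Au [v sv uvE]].
  have tI : ideal_span [set` t] `<=` I by rewrite tE; exact: ideal_addr.
  have AI : A j `<=` I by apply: span_sub => // _ [l _ <-].
  have [Mv|[s1 [g [s2 [t12 [c [nMc sc]]]]]]] := span_unit_coef sv.
    exfalso; pose b := [seq a l | l <- enum 'I_d & l != l0].
    apply: (@reduction_needs_generators b).
    - rewrite size_map size_filter -[X in (_ < X)%N](card_ord d) cardE.
      rewrite -(count_predC (fun l => l != l0)) -[X in (X < _)%N]addn0 ltn_add2l.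
      by rewrite -has_count; apply/hasP; exists l0; rewrite ?mem_enum //= eqxx.
    - by move=> _ /mapP[l _ ->]; apply: IM.
    have bE l : l != l0 -> ideal_span [set` b] (a l).
      move=> ll0; apply: sub_span => /=; apply: map_f.
      by rewrite mem_filter ll0 mem_enum.
    apply: span_sub; first by apply: ideal_addP; [exact: ideal_spanP|exact: ideal_mulP].
    move=> _ [l _ <-]; have [->|ll0] := eqVneq l l0; last first.
      by apply: ideal_addl; [exact: ideal_mulP|exact: bE].
    exists u; last by exists v => //; apply: ideal_mulS Mv.
    move: Au; apply: span_sub; first exact: ideal_spanP.
    move=> _ [l' /= l'j <-]; apply: bE.
    by rewrite -val_eqE /= neq_ltn l'j.
  have [w wc] := local_unit noethR localR nMc.
  exists (s1 ++ s2); split.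
    by move: tsz; rewrite t12 !size_cat /= addnS subSS subSn ?(ltnW jd) // => -[].
  have sub12 h : h \in s1 ++ s2 -> h \in t.
    by rewrite t12 !mem_cat inE => /orP[]->; rewrite ?orbT.
  have idS : ideal (ideal_add (A j.+1) (ideal_span [set` s1 ++ s2])).
    by apply: ideal_addP => //; exact: ideal_spanP.
  have AA : A j `<=` A j.+1.
    apply: span_sub => // _ [l /= lj <-]; apply: sub_span.
    by exists l => //=; exact: leqW.
  apply/seteqP; split.
    rewrite tE; apply: ideal_add_sub => //.
      by apply: subset_trans AA _; apply: ideal_addl; exact: ideal_spanP.
    apply: span_sub => // h /=; rewrite t12 mem_cat inE.
    have [hs _|] := boolP (h \in s1 ++ s2).
      by apply: ideal_addr => //; exact: sub_span.
    rewrite mem_cat negb_or => /andP[/negPf -> /negPf ->]; rewrite orbF /= => /eqP ->.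
    have -> : g = w * (a l0 - u - (v - c * g)).
      rewrite -uvE; transitivity ((w * c) * g); last by ring.
      by rewrite wc mul1r.
    apply: (idealMl idS); apply: (idealB idS); last exact: ideal_addr.
    apply: ideal_addl; first exact: ideal_spanP.
    apply: (idealB (idA _)); last exact: AA.
    by apply: sub_span; exists l0 => /=.
  apply: ideal_add_sub => //; first by apply: span_sub => // _ [l _ <-].
  by apply: span_sub => // h /= /sub12 ht; apply: tI; exact: sub_span.
have [t [tsz tE]] := step d (leqnn d); rewrite subSn // subnn in tsz.
case: t tsz tE => [|x [|]] // _ tE.
exists x; rewrite tE; congr (ideal_add (ideal_span _) (ideal_span _)).
  by apply/seteqP; split=> [_ [l _ <-]|_ [l _ <-]]; exists l => /=.
by apply/seteqP; split=> y /=; rewrite inE => /eqP.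
Qed.

End MinimalReductions.

(** * The bound on the reduction number *)

(** With at most [d + 1] generators [y] every matrix of relations will do. With
    more of them it matters that the entries of [C] come from an ideal with [d]
    generators that contains [x^(n + 1)], hence also the square of [x^n]. *)
Lemma det_multiplication_matrix (R : comNzRingType) (m : idealr R) d n k
    (a : 'I_d -> R) (x : R) (y : 'cV[R]_k) (C : 'M[R]_k) :
  noetherian R -> local_ring m -> krull_dim R d -> (0 < d)%N -> (0 < n)%N ->
  (forall z, z \in m <-> exists c, z = dot y c) ->
  (forall l, a l \in m) ->
  (forall i j, ideal_span (range a) (C i j)) ->
  ideal_span (range a) (x ^+ n.+1) ->
  ((x ^+ n)%:M - C) *m y = 0 -> \det ((x ^+ n)%:M - C) = 0.
Proof.
move=> noethR localR dimR d_gt0 n_gt0 my am CQ xQ Cy.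
have [kd|dk] := leqP k d.+1; first exact: (det_relations_local noethR localR dimR d_gt0 kd my).
have comb z : ideal_span (range a) z -> exists c : 'I_d -> R, z = \sum_l c l * a l.
  apply: (@span_sub _ _ [set z | exists c : 'I_d -> R, z = \sum_l c l * a l]).
    apply/idealP; split=> [|b _ _ [u ->] [v ->]].
      by exists (fun=> 0); rewrite big1 // => l _; rewrite mul0r.
    exists (fun l => b * u l + v l); rewrite mulr_sumr -big_split /=.
    by apply: eq_bigr => l _; ring.
  move=> _ [l _ <-]; exists (fun j => (j == l)%:R).
  by rewrite (bigD1 l) //= eqxx mul1r big1 ?addr0 // => j /negPf ->; rewrite mul0r.
have /choice[A AE] l : exists v, a l = dot y v by apply/my.
pose Q := \matrix_l A l.
have Qy l : (Q *m y) l 0 = a l by rewrite mulmx_dot rowK -AE.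
have /choice[c cE] (p : 'I_k * 'I_k) :
    exists u : 'I_d -> R, C p.1 p.2 = \sum_l u l * a l by exact: comb.
have idQ : ideal (ideal_span (range a)) by exact: ideal_spanP.
have [q qE] := comb _ (idealMl idQ (x ^+ n.-1) xQ).
apply: (@det_few_coefficients _ _ _ y Q C (fun l => \matrix_(i, j) c (i, j) l)
  (x ^+ n) (\row_l q l)) => //.
  apply/matrixP => i j; rewrite summxE (cE (i, j)); apply: eq_bigr => l _.
  by rewrite mxE Qy mxE mulrC.
rewrite mxE -exprM; transitivity (x ^+ n.-1 * x ^+ n.+1).
  by rewrite -exprD; congr (x ^+ _); lia.
by rewrite qE; apply: eq_bigr => l _; rewrite Qy mxE.
Qed.

Theorem proposition3p1 (R : comNzRingType) (m : idealr R) (d n : nat)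
    (I Q : set R) :
  noetherian R ->
  local_ring m ->
  krull_dim R d ->
  (1 <= d)%N ->
  infinite_set [set: {ideal_quot m}]%classic ->
  almost_complete_intersection m d I ->
  minimal_reduction d I Q ->
  (0 < n)%N ->
  quotient_length (ideal_exp I n) (ideal_mul Q (ideal_exp I n.-1)) 1 ->
  (reduction_number d I <= n * nu [set` m]%classic - 1)%N.
Proof.
move=> noethR localR dimR d_gt0 inf_residue [[prI radI] nuI].
move=> [[a0 QE] QI [r redQ]] n_gt0 len1.
pose M : set R := [set` m]; have idM : ideal M := local_ideal localR.
have idI : ideal I by case: len1 => idIn _ _ _; case: prI => -[I0 _ Il] _;
  apply/idealP; split=> [|u v w Iv Iw]; [move: I0; rewrite inE|
  have := Il u v w; rewrite !inE; exact].
have IM : I `<=` M by rewrite /M -radI => x Ix; exists 1%N; rewrite expr1.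
have MI x : M x -> exists e, I (x ^+ e) by rewrite /M -radI.
pose a := tnth a0.
have {}QE : Q = ideal_span (range a).
  rewrite QE; congr ideal_span; apply/seteqP; split=> z /=.
    by move=> /tnthP[l ->]; exists l.
  by move=> [l _ <-]; exact: mem_tnth.
rewrite {Q}QE in QI redQ len1.
set Q := ideal_span (range a) in QI redQ len1.
have idQ : ideal Q by exact: ideal_spanP.
have [x IE] : exists x, I = ideal_add Q (ideal_span [set x]).
  have [s [sz sE]] := nu_generators noethR idI.
  by apply: (reduction_complement noethR localR dimR idI IM MI QI redQ (s := s));
     rewrite ?sz.
have Ix : I x by rewrite IE; apply: ideal_addr => //; exact: sub_span.
pose K := ideal_mul Q (ideal_exp I n.-1); have idK : ideal K by exact: ideal_mulP.
(* Between [K] and [I^n] there is no room for [K + M I^n], which is not [I^n] by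
   Nakayama's lemma. *)
have xnM w : M w -> K (w * x ^+ n).
  pose L := ideal_add K (ideal_mul M (ideal_exp I n)).
  have idL : ideal L by apply: ideal_addP => //; exact: ideal_mulP.
  have KI : K `<=` ideal_exp I n by case: len1.
  have [||LK|JL] := length1_between len1 idL.
  - by apply: ideal_addl; exact: ideal_mulP.
  - apply: ideal_add_sub => //; first exact: ideal_expP.
    by apply: ideal_mul_subr; exact: ideal_expP.
  - move=> Mw; apply: LK; apply: ideal_addr => //.
    by apply: mem_ideal_mul => //; exact: mem_ideal_exp.
  case: (length1_proper len1).
  by apply: (nakayama_local noethR localR) => //; exact: ideal_expP.
have [s [sz sE]] := nu_generators noethR idM.
rewrite -[nu _]sz -/M.
(* There are at least [d] generators by Krull's height theorem. *)
have s_gt0 : (0 < size s)%N.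
  apply: leq_trans d_gt0 _; rewrite leqNgt; apply/negP => sd.
  have [|P [pP _ MP Ps]] := local_dim_avoid noethR localR dimR sd.
    by move=> z zs; rewrite -/M sE; exact: sub_span.
  apply: MP; rewrite -/M sE; apply: span_sub => //.
  exact: prime_ideal_ideal.
have [cC|] := pselect (forall w, M w -> ideal_mul M K (w * x ^+ n)); last first.
  (* A relation of degree [n] with a unit coefficient changes the reduction. *)
  move=> /existsNP[w /not_implyP[Mw nMKw]].
  have [t tx] : exists t : 'I_d -> R, ideal_mul
      (ideal_span (range (fun l => a l - t l * x))) (ideal_exp I n.-1) (x ^+ n).
    rewrite IE; apply: (unit_form noethR localR inf_residue n_gt0 Mw);
      rewrite -IE; [exact: xnM|exact: nMKw].
  pose b l := a l - t l * x; pose Q' := ideal_span (range b).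
  have idQ' : ideal Q' by exact: ideal_spanP.
  have IE' : I = ideal_add Q' (ideal_span [set x]).
    have idQx : ideal (ideal_add Q' (ideal_span [set x])).
      by apply: ideal_addP => //; exact: ideal_spanP.
    apply/seteqP; split.
      rewrite IE; apply: ideal_add_sub => //; last exact: ideal_addr.
      apply: span_sub => // _ [l _ <-]; exists (b l).
        by apply: sub_span; exists l.
      by exists (t l * x); [apply/span1P; exists (t l)|rewrite subrK].
    apply: ideal_add_sub => //; last by apply: span_sub => // _ ->.
    apply: span_sub => // _ [l _ <-]; apply: (idealB idI); last exact: (idealMl idI).
    by apply: QI; apply: sub_span; exists l.
  have red' : ideal_exp I n.-1.+1 = ideal_mul Q' (ideal_exp I n.-1).
    rewrite IE'; apply: reduction_of_power => //.
    by rewrite -IE' prednK.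
  apply: (@leq_trans n.-1).
    apply: (reduction_number_le _ red'); apply: (minimal_reduction_range _ red').
    by rewrite [X in _ `<=` X]IE'; apply: ideal_addl; exact: ideal_spanP.
  by rewrite subn1 -!subn1 leq_sub2r // leq_pmulr.
(* Now the generators [y] of [M] satisfy [x^n y = A y] with entries of [A] in
   [K]. *)
pose k := size s; pose y : 'cV[R]_k := \col_i s`_i.
have my z : z \in m <-> exists c, z = dot y c.
  have -> : (z \in m) <-> M z by [].
  rewrite sE span_seqP; split=> -[c ->].
    by exists (\row_i c i); rewrite dotE; apply: eq_bigr => i _; rewrite !mxE.
  by exists (c 0); rewrite dotE; apply: eq_bigr => i _; rewrite !mxE.
have /choice[C CP] (i : 'I_k) : exists c : 'I_k -> R,
    (forall j, K (c j)) /\ s`_i * x ^+ n = \sum_j c j * s`_j.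
  apply: mul_span_seqP => //; rewrite -sE ideal_mulC.
  by apply: cC; rewrite sE; apply: sub_span => /=; exact: mem_nth.
pose A := \matrix_(i, j) C i j.
have Ay : ((x ^+ n)%:M - A) *m y = 0.
  apply/matrixP => i j; rewrite ord1 mulmxBl mul_scalar_mx !mxE.
  have [_ E] := CP i; rewrite mulrC E; apply/eqP; rewrite subr_eq0; apply/eqP.
  by apply: eq_bigr => l _; rewrite !mxE.
have KQ : K `<=` Q by exact: ideal_mul_subl.
have detA : \det ((x ^+ n)%:M - A) = 0.
  apply: (det_multiplication_matrix (d := d) (a := a) noethR localR dimR) => //.
  - by move=> l; apply: IM; apply: QI; apply: sub_span; exists l.
  - by move=> i j; rewrite mxE; apply: KQ; case: (CP i).
  by rewrite exprS; apply: KQ; apply: xnM; exact: IM.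
pose N := (n * k)%N; have N_gt0 : (0 < N)%N by rewrite muln_gt0 n_gt0.
have xN : ideal_mul Q (ideal_exp I N.-1) (x ^+ N.-1.+1).
  rewrite prednK //.
  have FK : K `<=` ideal_exp I n by case: len1.
  have idF : ideal (ideal_exp I n) by exact: ideal_expP.
  have diag i j : ideal_exp I n (((x ^+ n)%:M : 'M_k) i j).
    rewrite mxE; case: eqP => _; rewrite ?mulr0n ?mulr1n; last exact: ideal0.
    exact: mem_ideal_exp.
  (* The determinant, which is zero, is compared with that of the scalar matrix. *)
  have := @det_congr _ _ K k (x ^+ n)%:M ((x ^+ n)%:M - A) idF FK diag.
  rewrite detA subr0 det_scalar -exprM /K -ideal_mulA -ideal_expM -ideal_expD.
  have -> : (n.-1 + n * k.-1)%N = N.-1.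
    have k_gt0 : (0 < k)%N := s_gt0.
    by rewrite /N -[in RHS](prednK k_gt0) mulnS -[in LHS]subn1 addnC addnBA // subn1 addnC.
  apply=> i j.
    rewrite !mxE; apply: (idealB idF).
      by have := diag i j; rewrite mxE.
    by apply: FK; case: (CP i).
  rewrite !mxE opprB addrC subrK; exact: (CP i).1.
rewrite subn1; apply: (@reduction_number_le _ _ _ Q).
  exact: (minimal_reduction_range QI redQ).
rewrite {1}IE; move: xN; rewrite {1}IE => /(reduction_of_power idQ) ->.
by rewrite -IE.
Qed.
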